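(* There exists a function $f\in\bigcap_{\alpha\in(0,1)}C^{1,\alpha}([0,1]^2)$ which has the weak Sard property, i.e. $f_\#(\mathbf{1}_{S\cap E^*}\mathcal{L}^2)\perp\mathcal{L}^1$, but does not have the relaxed Sard property, i.e. $f_\#(\mathbf{1}_{S}\mathcal{L}^2)$ is not mutually singular with $\mathcal{L}^1$.
   Context: $\mathcal{L}^d$ denotes Lebesgue measure on $\mathbb{R}^d$, $\mathcal{H}^1$ the one-dimensional Hausdorff measure, $\mathbf{1}_A$ the indicator function of $A$, $f_\#\mu$ the pushforward of a measure $\mu$ under $f$, and $\mu\perp\nu$ means mutual singularity. $C^{1,\alpha}([0,1]^2)$ is the space of $C^1$ functions whose gradient is $\alpha$-Hölder continuous. The critical set $S$ of $f$ is the set of all $x\in[0,1]^2$ at which $f$ is either not differentiable or $\nabla f(x)=0$. For $t\in\mathbb{R}$ let $E_t=f^{-1}(t)$, let $E_t^*$ be the union of all connected components of $E_t$ with strictly positive $\mathcal{H}^1$-measure, and $E^*:=\bigcup_{t\in\mathbb{R}}E_t^*$. *)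

(* Defs.v *)
From mathcomp Require Import all_boot all_order all_algebra.
From mathcomp Require Import all_classical all_reals all_analysis.
Import Order.TTheory GRing.Theory Num.Theory.
Import numFieldNormedType.Exports.
Set Implicit Arguments. Unset Strict Implicit. Unset Printing Implicit Defensive.
Local Open Scope classical_set_scope.
Local Open Scope ring_scope.

Section Defs.
Variable R : realType.

Definition square : set (R * R) :=
  [set x | 0 <= x.1 <= 1 /\ 0 <= x.2 <= 1].
Definition open_square : set (R * R) :=
  [set x | 0 < x.1 < 1 /\ 0 < x.2 < 1].

Definition edist (x y : R * R) : R :=
  Num.sqrt ((x.1 - y.1) ^+ 2 + (x.2 - y.2) ^+ 2).

(* Euclidean diameter (diam of the empty set is 0). *)
Definition ediam (A : set (R * R)) : \bar R :=
  ereal_sup ([set 0%E] `|` [set (edist xy.1 xy.2)%:E | xy in A `*` A]).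

(* delta-approximating Hausdorff content and the 1-dim Hausdorff measure
   (normalised so that H^1 of a segment is its length). *)
Definition H1_delta (delta : R) (A : set (R * R)) : \bar R :=
  ereal_inf [set (\sum_(0 <= n <oo) ediam (C n))%E | C in
    [set C : nat -> set (R * R) |
      A `<=` \bigcup_n C n /\ forall n, (ediam (C n) <= delta%:E)%E]].

Definition H1 (A : set (R * R)) : \bar R :=
  ereal_sup [set H1_delta delta A | delta in [set delta : R | 0 < delta]].

Definition grad (f : R * R -> R) (x : R * R) : R * R :=
  ('d f x (1, 0), 'd f x (0, 1)).

Definition C1alpha_all (f : R * R -> R) : Prop :=
  {within square, continuous f} /\
  (forall x, open_square x -> differentiable f x) /\
  (forall alpha : R, 0 < alpha < 1 ->
     exists C : R, forall x y, open_square x -> open_square y ->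
       edist (grad f x) (grad f y) <= C * powR (edist x y) alpha).

Definition crit (f : R * R -> R) : set (R * R) :=
  [set x | square x /\ (~ differentiable f x \/ forall v, 'd f x v = 0)].

Definition Estar (f : R * R -> R) : set (R * R) :=
  [set x | square x /\
     (0 < H1 (connected_component (square `&` f @^-1` [set f x]) x))%E].

Definition L2 : set (R * R) -> \bar R :=
  (@lebesgue_measure R \x @lebesgue_measure R)%E.

(* f_#(1_A L^2) is mutually singular with L^1 *)
Definition push_singular (f : R * R -> R) (A : set (R * R)) : Prop :=
  exists N : set R, [/\ measurable N, (@lebesgue_measure R N = 0)%E &
    L2.-negligible (A `&` f @^-1` (~` N))].

End Defs.

(* Main.v *)
Require Import Defs.
From HB Require Import structures.
From mathcomp Require Import all_boot all_order all_algebra.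
From mathcomp Require Import all_classical all_reals all_analysis.
From mathcomp Require Import measurable_realfun.
From mathcomp Require Import ring lra.
Import Order.TTheory GRing.Theory Num.Theory.
Import numFieldNormedType.Exports.
Set Implicit Arguments. Unset Strict Implicit. Unset Printing Implicit Defensive.
Local Open Scope classical_set_scope.
Local Open Scope ring_scope.

(** The function is a sum over the levels [n] of a planar Cantor set [C x C] of
    positive measure. Level [n] consists of [4 ^ n] squares of side about
    [2 ^- n], separated by gaps of size about [2 ^- n / n ^ 2]; on each square
    sits a plateau bump of height [4 ^- n * a], with [a] in {-3, -1, 1, 3} telling
    the four children of a square apart. The level-[n] term has gradient of size
    [n ^ 2 * 2 ^- n] and second derivatives of size [n ^ 4], so interpolation
    makes the gradient [alpha]-Hoelder for every [alpha < 1].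

    The gradient vanishes on [C x C], where the function reads off base-4 digits
    and therefore pushes area forward to a measure bounded by a multiple of length:
    the relaxed Sard property fails. On the boundary of every square, and at every
    critical point outside [C x C], the value is a finite sum of the heights, hence
    rational. So for a critical point with irrational value the component of
    the level set is trapped in the nested squares around it and is a singleton:
    the weak Sard property holds, with the rationals as exceptional null set.

    The one-dimensional Cantor set is generated by the continuous folding maps
    [z |-> `|z| - h], which turn the [2 ^ n] bumps of a level into a single one. *)

(** * Second-order Taylor bounds and folding *)

Section Taylor.
Variable R : realType.
Implicit Types (g dg : R -> R) (A B h x y z : R).

(** [A] bounds the first derivative and [B] half the second. Remainders replace second derivatives
    so that the conditions make sense for functions of class C^1 only and survive composition with
    [|z|]. *)
Definition taylor2 A B g dg : Prop :=
  [/\ forall x, `|dg x| <= A,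
      forall x y, `|g y - g x| <= A * `|y - x| &
      forall x y, `|g y - g x - dg x * (y - x)| <= B * (y - x) ^+ 2].

(** The expansions at [x] and at [y] are added; the values of [g] cancel. *)
Lemma taylor2_lip A B g dg x y : taylor2 A B g dg ->
  `|dg y - dg x| <= 2 * B * `|y - x|.
Proof.
move=> [_ _ gT]; have [->|xy] := eqVneq x y; first by rewrite !subrr !normr0 mulr0.
have yx0 : 0 < `|y - x| by rewrite normr_gt0 subr_eq0 eq_sym.
have h1 := gT x y; have h2 := gT y x.
rewrite -(ler_pM2r yx0) -normrM.
have -> : 2 * B * `|y - x| * `|y - x| = 2 * B * (y - x) ^+ 2.
  by rewrite -(real_normK (num_real (y - x))); ring.
have -> : (dg y - dg x) * (y - x) =
   (g y - g x - dg x * (y - x)) + (g x - g y - dg y * (x - y)) by ring.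
apply: le_trans (ler_normD _ _) _.
have -> : 2 * B * (y - x) ^+ 2 = B * (y - x) ^+ 2 + B * (x - y) ^+ 2 by ring.
exact: lerD.
Qed.

Lemma taylor2_le A B A' B' g dg : A <= A' -> B <= B' ->
  taylor2 A B g dg -> taylor2 A' B' g dg.
Proof.
move=> AA BB [g1 g2 g3]; split=> [x|x y|x y].
- exact: le_trans AA.
- by apply: le_trans (g2 x y) _; rewrite ler_wpM2r.
- by apply: le_trans (g3 x y) _; rewrite ler_wpM2r// sqr_ge0.
Qed.

Lemma taylor2_shift A B g dg h : taylor2 A B g dg ->
  taylor2 A B (fun x => g (x - h)) (fun x => dg (x - h)).
Proof.
move=> [g1 g2 g3]; split=> [x|x y|x y]; first exact: g1.
- by apply: le_trans (g2 _ _) _; rewrite opprB addrA subrK.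
- by have := g3 (x - h) (y - h); rewrite opprB addrA subrK.
Qed.

Lemma taylor2_scale A B g dg (c : R) : taylor2 A B g dg ->
  taylor2 (A * `|c|) (B * c ^+ 2) (fun x => g (c * x)) (fun x => c * dg (c * x)).
Proof.
move=> [g1 g2 g3]; split=> [x|x y|x y].
- by rewrite normrM mulrC ler_wpM2r//.
- by apply: le_trans (g2 _ _) _; rewrite -mulrBr normrM mulrA.
- have := g3 (c * x) (c * y).
  have -> : B * (c * y - c * x) ^+ 2 = B * c ^+ 2 * (y - x) ^+ 2 by ring.
  by congr (`|_| <= _); ring.
Qed.

(* Folding at the origin creates no kink because dg vanishes there. *)
Lemma taylor2_even A B g dg : taylor2 A B g dg -> dg 0 = 0 ->
  taylor2 A B (fun z => g `|z|) (fun z => Num.sg z * dg `|z|).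
Proof.
move=> gT dg0; have [g1 g2 g3] := gT; split=> [x|x y|x y].
- rewrite normrM normr_sg; case: eqP => _ /=; rewrite ?mul0r ?mul1r//.
  by rewrite (le_trans _ (g1 0)).
- apply: le_trans (g2 _ _) _; rewrite ler_wpM2l ?(le_trans _ (g1 0))//.
  by rewrite distrC (distrC y) ler_dist_dist.
- have A0 := le_trans (normr_ge0 _) (g1 0).
  have sgE u : 0 <= u -> Num.sg u * dg `|u| = dg u.
    by rewrite le_eqVlt => /predU1P[<-|u0]; rewrite ?normr0 ?dg0 ?mulr0// gtr0_sg// mul1r gtr0_norm.
  have sgEN u : u <= 0 -> Num.sg u * dg `|u| = - dg (- u).
    rewrite le_eqVlt => /predU1P[->|u0]; first by rewrite oppr0 normr0 dg0 mulr0 oppr0.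
    by rewrite ltr0_sg// mulN1r ltr0_norm.
  have lipd a : `|dg a| <= 2 * B * `|a|.
    by have := taylor2_lip 0 a gT; rewrite dg0 !subr0.
  have B0 : 0 <= B.
    by have := g3 0 1; rewrite subr0 expr1n !mulr1 => /(le_trans (normr_ge0 _)).
  (* Points on opposite sides of the origin are compared through 0. The extra term [dg a * b] is at
     most [2 * B * a * b] because [dg 0 = 0], and this completes the square. *)
  have key a b : 0 <= a -> 0 <= b -> `|g b - g a + dg a * (b + a)| <= B * (b + a) ^+ 2.
    move=> a0 b0.
    have -> : g b - g a + dg a * (b + a) =
      (g b - g 0 - dg 0 * (b - 0)) + (g 0 - g a - dg a * (0 - a)) + dg a * b.
      by rewrite dg0; ring.
    have -> : B * (b + a) ^+ 2 = B * (b - 0) ^+ 2 + B * (0 - a) ^+ 2 + 2 * B * a * b by ring.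
    apply: le_trans (ler_normD _ _) (lerD (le_trans (ler_normD _ _) (lerD _ _)) _) => //.
    by rewrite normrM (ger0_norm b0) ler_wpM2r//; have := lipd a; rewrite (ger0_norm a0).
  have [x0|/ltW x0] := leP 0 x; have [y0|/ltW y0] := leP 0 y.
  + by rewrite sgE// (ger0_norm x0) (ger0_norm y0).
  + rewrite sgE// (ger0_norm x0) (ler0_norm y0).
    have := key x (- y) x0; rewrite oppr_ge0 => /(_ y0).
    have -> : (- y + x) ^+ 2 = (y - x) ^+ 2 by ring.
    by congr (`|_| <= _); ring.
  + rewrite sgEN// (ler0_norm x0) (ger0_norm y0).
    have := key (- x) y; rewrite oppr_ge0 => /(_ x0 y0).
    by congr (`|_| <= _); ring.
  + rewrite sgEN// (ler0_norm x0) (ler0_norm y0).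
    have := g3 (- x) (- y).
    have -> : (- y - - x) ^+ 2 = (y - x) ^+ 2 by ring.
    by congr (`|_| <= _); ring.
Qed.

(** The odd extension is continuous because [g 0 = 0], and its derivative is even, so no kink
    arises. It handles the terms that carry a sign [sgf]. *)
Lemma taylor2_odd A B g dg : taylor2 A B g dg -> g 0 = 0 ->
  taylor2 A B (fun z => Num.sg z * g `|z|) (fun z => dg `|z|).
Proof.
move=> gT g0; have [g1 g2 g3] := gT.
have sgE u : 0 <= u -> Num.sg u * g `|u| = g u.
  by rewrite le_eqVlt => /predU1P[<-|u0]; rewrite ?normr0 ?g0 ?mulr0// gtr0_sg// mul1r gtr0_norm.
have sgEN u : u <= 0 -> Num.sg u * g `|u| = - g (- u).
  rewrite le_eqVlt => /predU1P[->|u0]; first by rewrite oppr0 normr0 g0 mulr0 oppr0.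
  by rewrite ltr0_sg// mulN1r ltr0_norm.
have A0 := le_trans (normr_ge0 _) (g1 0).
have keyl a b : 0 <= a -> 0 <= b -> `|g b + g a| <= A * (b + a).
  move=> a0 b0; rewrite mulrDr; apply: le_trans (ler_normD _ _) _.
  have := g2 0 a; have := g2 0 b; rewrite g0 !subr0 (ger0_norm a0) (ger0_norm b0).
  exact: lerD.
have B0 : 0 <= B.
  by have := g3 0 1; rewrite subr0 expr1n !mulr1 => /(le_trans (normr_ge0 _)).
have key a b : 0 <= a -> 0 <= b -> `|g b + g a - dg a * (b + a)| <= B * (b + a) ^+ 2.
  move=> a0 b0.
  have -> : g b + g a - dg a * (b + a) =
      (g b - g 0 - dg 0 * (b - 0)) - (g 0 - g a - dg a * (0 - a)) + - ((dg a - dg 0) * b).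
    by rewrite g0; ring.
  have -> : B * (b + a) ^+ 2 = B * (b - 0) ^+ 2 + B * (0 - a) ^+ 2 + 2 * B * a * b by ring.
  apply: le_trans (ler_normD _ _) (lerD (le_trans (ler_normB _ _) (lerD _ _)) _) => //.
  rewrite normrN normrM (ger0_norm b0) ler_wpM2r//.
  by have := taylor2_lip 0 a gT; rewrite subr0 (ger0_norm a0).
split=> [x|x y|x y]; first exact: g1.
- have [x0|/ltW x0] := leP 0 x; have [y0|/ltW y0] := leP 0 y.
  + by rewrite !sgE.
  + rewrite (sgE _ x0) (sgEN _ y0) distrC opprK addrC (distrC y).
    rewrite [`|x - y|]ger0_norm ?subr_ge0 ?(le_trans y0)// (addrC x).
    by rewrite keyl// oppr_ge0.
  + rewrite (sgE _ y0) (sgEN _ x0) opprK [`|y - x|]ger0_norm ?subr_ge0 ?(le_trans x0)//.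
    by rewrite keyl// oppr_ge0.
  + rewrite !sgEN// opprK addrC; have := g2 (- y) (- x).
    by rewrite opprK (addrC (- x)).
- have [x0|/ltW x0] := leP 0 x; have [y0|/ltW y0] := leP 0 y.
  + by rewrite !sgE// (ger0_norm x0).
  + rewrite (sgE _ x0) (sgEN _ y0) (ger0_norm x0).
    have := key x (- y) x0; rewrite oppr_ge0 => /(_ y0).
    have -> : (- y + x) ^+ 2 = (y - x) ^+ 2 by ring.
    by rewrite -normrN; congr (`|_| <= _); ring.
  + rewrite (sgE _ y0) (sgEN _ x0) (ler0_norm x0).
    have := key (- x) y; rewrite oppr_ge0 => /(_ x0 y0).
    by congr (`|_| <= _); ring.
  + rewrite !sgEN// (ler0_norm x0).
    have := g3 (- x) (- y).
    have -> : (- y - - x) ^+ 2 = (y - x) ^+ 2 by ring.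
    by rewrite -normrN; congr (`|_| <= _); ring.
Qed.

(** * A cubic step function and its Taylor bounds *)

Definition clamp01 x : R := Num.max 0 (Num.min 1 x).
Definition smoothstep x : R := 3 * clamp01 x ^+ 2 - 2 * clamp01 x ^+ 3.
Definition dsmoothstep x : R := 6 * clamp01 x * (1 - clamp01 x).

Variant clamp01_spec x : R -> Type :=
| Clamp01Lt of x < 0 : clamp01_spec x 0
| Clamp01In of 0 <= x <= 1 : clamp01_spec x x
| Clamp01Gt of 1 < x : clamp01_spec x 1.

Lemma clamp01P x : clamp01_spec x (clamp01 x).
Proof.
rewrite /clamp01; have [x1|x1] := leP x 1.
  by have [x0|x0] := leP 0 x; constructor; rewrite ?x0.
by rewrite (max_idPr ler01); exact: Clamp01Gt.
Qed.

Lemma clamp01_ge0 x : 0 <= clamp01 x.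
Proof. by rewrite /clamp01 le_max lexx. Qed.

Lemma clamp01_le1 x : clamp01 x <= 1.
Proof. by rewrite /clamp01 ge_max ler01 ge_min lexx. Qed.

(** The expression is the divided difference of [3 * x ^+ 2 - 2 * x ^+ 3] at [a] and [b]. *)
Lemma smoothstep_slope_bound (a b : R) : 0 <= a <= 1 -> 0 <= b <= 1 ->
  `|3 * (a + b) - 2 * (a ^+ 2 + a * b + b ^+ 2)| <= 2.
Proof.
move=> /andP[a0 a1] /andP[b0 b1]; rewrite ler_norml.
have := sqr_ge0 (a - b); have := sqr_ge0 (a + b - 1).
have : 0 <= a * (1 - a) by rewrite mulr_ge0// subr_ge0.
have : 0 <= b * (1 - b) by rewrite mulr_ge0// subr_ge0.
have : 0 <= a * (1 - b) by rewrite mulr_ge0// subr_ge0.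
have : 0 <= b * (1 - a) by rewrite mulr_ge0// subr_ge0.
by move=> *; apply/andP; split; nra.
Qed.

Lemma taylor2_smoothstep : taylor2 2 4 smoothstep dsmoothstep.
Proof.
have c01 x : 0 <= clamp01 x <= 1 by rewrite clamp01_ge0 clamp01_le1.
split=> [x|x y|x y]; rewrite /smoothstep /dsmoothstep.
- by rewrite ler_norml; case: clamp01P => *; apply/andP; split; nra.
- have -> (a b : R) : 3 * b ^+ 2 - 2 * b ^+ 3 - (3 * a ^+ 2 - 2 * a ^+ 3) =
    (3 * (a + b) - 2 * (a ^+ 2 + a * b + b ^+ 2)) * (b - a) by ring.
  rewrite normrM ler_pM// ?smoothstep_slope_bound//.
  have [xy|xy] := leP x y.
    by rewrite (ger0_norm (_ : 0 <= y - x)) ?subr_ge0// ler_norml;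
      case: clamp01P => *; case: clamp01P => *; apply/andP; split; lra.
  by rewrite (ltr0_norm (_ : y - x < 0)) ?subr_lt0// ler_norml;
      case: clamp01P => *; case: clamp01P => *; apply/andP; split; lra.
(* The remainder splits into that of the cubic at the clamped points and the mismatch [c - (b - a)]
   of the increments, weighted by the slope at [x]. The weight vanishes when [x] is clamped, so the
   delicate cases have [x] inside and [y] outside the unit interval. *)
- have -> : forall a b c : R,
    3 * b ^+ 2 - 2 * b ^+ 3 - (3 * a ^+ 2 - 2 * a ^+ 3) - 6 * a * (1 - a) * c =
    (3 - 2 * b - 4 * a) * (b - a) ^+ 2 - 6 * a * (1 - a) * (c - (b - a)) by move=> *; ring.
  have /andP[a0 a1] := c01 x; have /andP[b0 b1] := c01 y.
  have h1 : `|(3 - 2 * clamp01 y - 4 * clamp01 x) * (clamp01 y - clamp01 x) ^+ 2| <=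
      3 * (clamp01 y - clamp01 x) ^+ 2.
    rewrite normrM (ger0_norm (sqr_ge0 _)) ler_wpM2r ?sqr_ge0// ler_norml.
    by apply/andP; split; lra.
  apply: le_trans (ler_normB _ _) _; apply: le_trans (lerD h1 (lexx _)) _.
  move: a0 a1 b0 b1 {h1}; case: clamp01P => hx; case: clamp01P => hy a0 a1 b0 b1;
    rewrite ?(mulr0, mul0r, subrr, normr0, addr0).
  all: have yx2 := sqr_ge0 (y - x); try by nra.
  + rewrite (_ : y - x - (0 - x) = y); last by ring.
    have /andP[? ?] := hx.
    have p0 : 0 <= x * (1 - x) * - y by rewrite mulr_ge0 ?mulr_ge0// ?oppr_ge0; lra.
    have p1 : 0 <= x * x * - y by rewrite mulr_ge0 ?mulr_ge0// oppr_ge0; lra.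
    rewrite ler0_norm; nra.
  + rewrite (_ : y - x - (1 - x) = y - 1); last by ring.
    have /andP[? ?] := hx.
    have p0 : 0 <= x * (1 - x) * (y - 1) by rewrite mulr_ge0 ?mulr_ge0//; lra.
    have p1 : 0 <= (1 - x) * (1 - x) * (y - 1) by rewrite mulr_ge0 ?mulr_ge0//; lra.
    rewrite ger0_norm; nra.
Qed.
End Taylor.

(** * The folded Cantor construction *)

Section Folding.
Variable R : realType.
Implicit Types (x y z : R) (n m : nat).

(* Half-length of the level-[n] intervals and width of their transition zones:
   two intervals of level [n + 1] exactly fill the plateau of one of level [n]. *)
Definition hw n : R := (1 + n.+1%:R^-1) / (4 * 2 ^+ n).
Definition tw n : R := hw n - 2 * hw n.+1.

(* Coordinate of [x] relative to the centre of its level-[n] interval, up to sign;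
   [hw n < `|fold n x|] as soon as [x] has fallen into a gap of a lower level. *)
Fixpoint fold n x : R :=
  if n is m.+1 then `|fold m x| - hw m.+1 else x - 2^-1.

Lemma hw0 : hw 0 = 2^-1.
Proof. by rewrite /hw expr0; field. Qed.

Lemma hw_gt0 n : 0 < hw n.
Proof. by rewrite divr_gt0 ?mulr_gt0 ?exprn_gt0// addr_gt0. Qed.

Lemma hw_ge n : (4 * 2 ^+ n)^-1 <= hw n.
Proof.
rewrite /hw [leRHS]mulrC ler_pMr ?invr_gt0 ?mulr_gt0 ?exprn_gt0//.
by rewrite lerDl invr_ge0.
Qed.

Lemma hw_le n : hw n <= (2 * 2 ^+ n)^-1.
Proof.
have p0 : 0 < 2 ^+ n :> R by rewrite exprn_gt0.
rewrite /hw ler_pdivrMr ?mulr_gt0//.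
have -> : (2 * 2 ^+ n)^-1 * (4 * 2 ^+ n) = 2 :> R by field; rewrite gt_eqF.
by rewrite -lerBrDl (_ : 2 - 1 = 1 :> R) ?invf_le1//; [rewrite ler1n|ring].
Qed.

(** The reciprocals of [n.+2] and [n.+3] are subtracted: gaps smaller by a quadratic factor leave
    positive measure, while [(tw n.+1)^-1] exceeds [2 ^+ n] only by a polynomial factor. *)
Lemma twSE n : tw n.+1 = (8 * 2 ^+ n * (n.+2%:R * n.+3%:R))^-1.
Proof.
rewrite /tw /hw !exprS -(natr1 n.+2) -(natr1 n.+1).
have : 0 <= n.+1%:R :> R by []. move: (n.+1%:R) => c c0.
have p0 : 0 < 2 ^+ n :> R by rewrite exprn_gt0.
move: (2 ^+ n) p0 => p p0.
field; rewrite !gt_eqF//; lra.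
Qed.

Lemma tw_gt0 n : 0 < tw n.
Proof.
case: n => [|n]; last by rewrite twSE invr_gt0 !mulr_gt0 ?exprn_gt0.
by rewrite /tw /hw !expr0 expr1; lra.
Qed.

Lemma twSV n : (tw n.+1)^-1 <= 8 * 2 ^+ n * n.+3%:R ^+ 2.
Proof.
rewrite twSE invrK ler_pM2l ?mulr_gt0 ?exprn_gt0//.
by rewrite expr2 ler_pM2r// ler_nat.
Qed.

Lemma hwS_lt n : 2 * hw n.+1 < hw n.
Proof. by rewrite -subr_gt0 tw_gt0. Qed.

(** A point that has reached the boundary or left its interval is outside from the next level on:
    folding subtracts [hw n.+1] from a number above [2 * hw n.+1]. *)
Lemma fold_dead n x : hw n <= `|fold n x| -> hw n.+1 < fold n.+1 x.
Proof. by move=> /= hx; have := hwS_lt n; lra. Qed.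

Lemma fold_dead_le n m x : (n < m)%N -> hw n <= `|fold n x| -> hw m < fold m x.
Proof.
elim: m => // m IHm; rewrite ltnS leq_eqVlt => /predU1P[->|nm] hx.
  exact: fold_dead.
apply: fold_dead; apply: ltW; apply: lt_le_trans (IHm nm hx) (ler_norm _).
Qed.

Lemma fold_alive n x : `|fold n.+1 x| <= hw n.+1 -> `|fold n x| <= 2 * hw n.+1.
Proof. by rewrite ler_norml /= => /andP[_]; lra. Qed.

Lemma fold_alive_lt n m x : (n < m)%N -> `|fold m x| <= hw m -> `|fold n x| < hw n.
Proof.
move=> nm hm; rewrite ltNge; apply/negP => /(fold_dead_le nm).
by rewrite ltNge => /negP; apply; apply: le_trans (ler_norm _) hm.
Qed.

Lemma fold_alive_le n m x : (n < m)%N -> `|fold m x| <= hw m ->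
  `|fold n x| <= 2 * hw n.+1.
Proof.
move=> nm hm; apply: fold_alive; move: nm; rewrite leq_eqVlt => /predU1P[->//|nm].
exact: ltW (fold_alive_lt nm hm).
Qed.

(** The folding point 0 is sent to the endpoint [- hw n.+1] of the next interval, so it is never
    interior at a later level. Hence the signs [sgf] of interior points do not vanish. *)
Lemma fold_neq0 n m x : (n < m)%N -> `|fold m x| < hw m -> fold n x != 0.
Proof.
move=> nm; apply: contraTN => /eqP fn0; rewrite -leNgt.
have fS : hw n.+1 <= `|fold n.+1 x|.
  by rewrite /= fn0 normr0 sub0r normrN ger0_norm // ltW // hw_gt0.
move: nm; rewrite leq_eqVlt => /predU1P[<-//|nm].
by apply: le_trans (ltW (fold_dead_le nm fS)) (ler_norm _).
Qed.

(** * Plateau bumps and their unfolding *)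

Definition bump n z : R := smoothstep ((hw n - `|z|) / tw n).
Definition dbump n z : R := - Num.sg z * dsmoothstep ((hw n - `|z|) / tw n) / tw n.

Lemma smoothstep_le0 x : x <= 0 -> smoothstep x = 0.
Proof.
move=> x0; rewrite /smoothstep; case: clamp01P => [_|/andP[x0' _]|]; first ring; last lra.
have -> : x = 0 by lra. ring.
Qed.

Lemma smoothstep_ge1 x : 1 <= x -> smoothstep x = 1.
Proof.
move=> x0; rewrite /smoothstep; case: clamp01P => [|/andP[_ x0']|_]; first lra; last ring.
have -> : x = 1 by lra. ring.
Qed.

Lemma dsmoothstep_le0 x : x <= 0 -> dsmoothstep x = 0.
Proof.
move=> x0; rewrite /dsmoothstep; case: clamp01P => [_|/andP[x0' _]|_]; [ring| |ring].
have -> : x = 0 by lra. ring.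
Qed.

Lemma dsmoothstep_ge1 x : 1 <= x -> dsmoothstep x = 0.
Proof.
move=> x0; rewrite /dsmoothstep; case: clamp01P => [_|/andP[_ x0']|_]; [ring| |ring].
have -> : x = 1 by lra. ring.
Qed.

Lemma dsmoothstep_gt0 x : 0 < x < 1 -> 0 < dsmoothstep x.
Proof.
move=> /andP[x0 x1]; rewrite /dsmoothstep; case: clamp01P => *; try lra.
by rewrite !mulr_gt0// subr_gt0.
Qed.

Lemma smoothstep_norm_le1 x : `|smoothstep x| <= 1.
Proof.
rewrite ler_norml /smoothstep; have := clamp01_ge0 x; have := clamp01_le1 x.
move: (clamp01 x) => c c1 c0.
have := sqr_ge0 c; have : 0 <= c ^+ 2 * (1 - c) by rewrite mulr_ge0 ?sqr_ge0// subr_ge0.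
have : 0 <= (1 - c) ^+ 2 * (1 + 2 * c) by rewrite mulr_ge0 ?sqr_ge0//; lra.
by move=> *; apply/andP; split; nra.
Qed.

Lemma bump_out n z : hw n <= `|z| -> bump n z = 0.
Proof.
by move=> hz; rewrite /bump smoothstep_le0// pmulr_lle0 ?invr_gt0 ?tw_gt0// subr_le0.
Qed.

Lemma bump_in n z : `|z| <= 2 * hw n.+1 -> bump n z = 1.
Proof.
move=> hz; rewrite /bump smoothstep_ge1// ler_pdivlMr ?tw_gt0// mul1r /tw; lra.
Qed.

Lemma dbump_out n z : hw n <= `|z| -> dbump n z = 0.
Proof.
move=> hz; rewrite /dbump dsmoothstep_le0 ?mulr0 ?mul0r//.
by rewrite pmulr_lle0 ?invr_gt0 ?tw_gt0// subr_le0.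
Qed.

Lemma dbump_in n z : `|z| <= 2 * hw n.+1 -> dbump n z = 0.
Proof.
move=> hz; rewrite /dbump dsmoothstep_ge1 ?mulr0 ?mul0r//.
rewrite ler_pdivlMr ?tw_gt0// mul1r /tw; lra.
Qed.

Lemma dbump_neq0 n z : 2 * hw n.+1 < `|z| < hw n -> dbump n z != 0.
Proof.
move=> /andP[z1 z2]; have t0 := tw_gt0 n.
have z0 : z != 0 by rewrite -normr_gt0; apply: le_lt_trans z1; rewrite mulr_ge0// ltW// hw_gt0.
apply: mulf_neq0; last by rewrite invr_neq0// gt_eqF.
apply: mulf_neq0; first by rewrite oppr_eq0 sgr_eq0.
rewrite gt_eqF//; apply: dsmoothstep_gt0; apply/andP; split.
  by rewrite divr_gt0// subr_gt0.
by rewrite ltr_pdivrMr// mul1r /tw; lra.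
Qed.

Lemma taylor2_bump n : taylor2 (2 / tw n) (4 / tw n ^+ 2) (bump n) (dbump n).
Proof.
have t0 := tw_gt0 n; have h0 := hw_gt0 n; have h1 := hw_gt0 n.+1.
have := taylor2_shift (hw n) (taylor2_scale (- (tw n)^-1) (@taylor2_smoothstep R)).
move=> /taylor2_even -/(_ _) /=.
rewrite normrN ger0_norm ?invr_ge0 ?ltW// sqrrN exprVn => T.
have -> : bump n = fun z => smoothstep (- (tw n)^-1 * (`|z| - hw n)).
  by apply/funext => z; rewrite /bump; congr smoothstep; ring.
have -> : dbump n = fun z =>
    Num.sg z * (- (tw n)^-1 * dsmoothstep (- (tw n)^-1 * (`|z| - hw n))).
  apply/funext => z; rewrite /dbump.
  have -> : - (tw n)^-1 * (`|z| - hw n) = (hw n - `|z|) / tw n by ring.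
  ring.
(* At the centre the argument of the step is [hw n / tw n], at least 1, where the slope is zero;
   this permits folding at 0. *)
apply: T; rewrite dsmoothstep_ge1 ?mulr0// sub0r mulrNN mulrC.
by rewrite ler_pdivlMr// mul1r /tw; lra.
Qed.

Fixpoint dfold n x : R := if n is m.+1 then dfold m x * Num.sg (fold m x) else 1.

(** One fold is undone at a time. Since [dg] vanishes at [- hw n.+1], the even extension has no
    kink, and its derivative again vanishes outside the level-[n] interval. The constants are
    unchanged because folding has slope 1 or -1. *)
Lemma taylor2_fold n A B (g dg : R -> R) : taylor2 A B g dg ->
  (forall z, hw n <= `|z| -> dg z = 0) ->
  taylor2 A B (fun x => g (fold n x)) (fun x => dfold n x * dg (fold n x)).
Proof.
elim: n g dg => [|n IHn] g dg gT dg0.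
  have -> : (fun x => dfold 0 x * dg (fold 0 x)) = fun x => dg (x - 2^-1).
    by apply/funext => x /=; rewrite mul1r.
  exact: taylor2_shift.
have h0 := hw_gt0 n.+1.
have gT' : taylor2 A B (fun z => g (`|z| - hw n.+1))
    (fun z => Num.sg z * dg (`|z| - hw n.+1)).
  apply: (taylor2_even (taylor2_shift (hw n.+1) gT)).
  by apply: dg0; rewrite sub0r normrN ger0_norm// ltW.
have -> : (fun x => dfold n.+1 x * dg (fold n.+1 x)) =
    fun x => dfold n x * (Num.sg (fold n x) * dg (`|fold n x| - hw n.+1)).
  by apply/funext => x /=; rewrite mulrA.
apply: (IHn _ _ gT') => z hz; rewrite dg0 ?mulr0//.
by apply: le_trans (ler_norm _); have := hwS_lt n; lra.
Qed.

(* [cell n] is the sum of all bumps of level [n + 1]; [sgf n] tells which half of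
   its level-[n] interval, up to reflection, a point belongs to. *)
Definition cell n x : R := bump n.+1 (fold n.+1 x).
Definition dcell n x : R := dfold n.+1 x * dbump n.+1 (fold n.+1 x).
Definition sgf n x : R := Num.sg (fold n x).

Definition slope n : R := 16 * 2 ^+ n * n.+3%:R ^+ 2.

Lemma slope_ge n : 2 / tw n.+1 <= slope n.
Proof. by have := twSV n; rewrite /slope; lra. Qed.

Lemma slope2_ge n : 4 / tw n.+1 ^+ 2 <= slope n ^+ 2.
Proof.
have -> : 4 / tw n.+1 ^+ 2 = (2 / tw n.+1) ^+ 2 by rewrite expr_div_n; congr (_ / _); ring.
by rewrite ler_sqr ?slope_ge// nnegrE ?divr_ge0 ?mulr_ge0 ?exprn_ge0// ltW ?tw_gt0.
Qed.

Lemma taylor2_cell n : taylor2 (slope n) (slope n ^+ 2) (cell n) (dcell n).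
Proof.
apply: taylor2_le (slope_ge n) (slope2_ge n) _.
by apply: taylor2_fold; [exact: taylor2_bump|exact: dbump_out].
Qed.

(** The sign jumps where [fold n x = 0], but there the cell vanishes. The product is the odd
    extension of a shifted bump, unfolded through [n] levels. *)
Lemma taylor2_sgcell n : taylor2 (slope n) (slope n ^+ 2)
  (fun x => sgf n x * cell n x) (fun x => sgf n x * dcell n x).
Proof.
apply: taylor2_le (slope_ge n) (slope2_ge n) _.
have h0 := hw_gt0 n.+1.
have hN : hw n.+1 <= `|0 - hw n.+1| by rewrite sub0r normrN ger0_norm// ltW.
have := taylor2_odd (taylor2_shift (hw n.+1) (taylor2_bump n.+1)) (bump_out hN).
move=> /(@taylor2_fold n) /=.
have -> : (fun x => sgf n x * dcell n x) =
   fun x => dfold n x * dbump n.+1 (`|fold n x| - hw n.+1).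
  apply/funext => x; rewrite /dcell /sgf /=; have [->|f0] := eqVneq (fold n x) 0.
    by rewrite normr0 dbump_out// !mulr0.
  rewrite -[RHS]mul1r (_ : 1 = Num.sg (fold n x) ^+ 2); first by ring.
  by rewrite sqr_sg f0.
apply=> z hz; rewrite dbump_out//.
by apply: le_trans (ler_norm _); have := hwS_lt n; lra.
Qed.

Lemma cell_norm_le1 n x : `|cell n x| <= 1.
Proof. exact: smoothstep_norm_le1. Qed.

Lemma sgf_norm_le1 n x : `|sgf n x| <= 1.
Proof. by rewrite normr_sg; case: eqP. Qed.

Lemma cell_out n x : hw n.+1 <= `|fold n.+1 x| -> cell n x = 0.
Proof. exact: bump_out. Qed.

Lemma dcell_out n x : hw n.+1 <= `|fold n.+1 x| -> dcell n x = 0.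
Proof. by move=> ?; rewrite /dcell dbump_out ?mulr0. Qed.

Lemma cell_in n m x : (n.+1 < m)%N -> `|fold m x| <= hw m -> cell n x = 1.
Proof. by move=> nm hm; apply: bump_in; apply: fold_alive_le hm. Qed.

Lemma dcell_in n m x : (n.+1 < m)%N -> `|fold m x| <= hw m -> dcell n x = 0.
Proof. by move=> nm hm; rewrite /dcell dbump_in ?mulr0//; apply: fold_alive_le hm. Qed.

Lemma dfold_neq0 n x : `|fold n x| < hw n -> dfold n x != 0.
Proof.
elim: n => [|n IHn] hx; first by rewrite /= oner_neq0.
rewrite mulf_neq0 ?sgr_eq0//; last exact: fold_neq0 hx.
by apply: IHn; apply: fold_alive_lt (ltW hx).
Qed.

Lemma dcell_neq0 n x : 2 * hw n.+2 < `|fold n.+1 x| < hw n.+1 -> dcell n x != 0.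
Proof.
by move=> /[dup] /andP[_ h2] h12; rewrite mulf_neq0 ?dfold_neq0// dbump_neq0.
Qed.

End Folding.

(** * Summation by interpolation *)

Section Interpolation.
Variable R : realType.
Implicit Types (a d u v rho : R) (c : nat -> R).

(** The smaller of [u] and [d] is written as the product of its powers with exponents [1 - a] and
    [a]; then one factor is enlarged. *)
Lemma le_powR_interp a u d v : 0 < a < 1 -> 0 <= u -> 0 <= d -> v <= u -> v <= d ->
  v <= u `^ (1 - a) * d `^ a.
Proof.
move=> /andP[a0 a1] u0 d0 vu vd.
have split_powR w : 0 <= w -> w `^ (1 - a) * w `^ a = w.
  by move=> w0; rewrite -powRD ?subrK ?oner_eq0// powRr1.
have [du|/ltW ud] := leP d u.
- apply: le_trans vd _; rewrite -{1}(split_powR d)// ler_wpM2r ?powR_ge0//.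
  by rewrite ge0_ler_powR ?nnegrE// subr_ge0 ltW.
- apply: le_trans vu _; rewrite -{1}(split_powR u)// ler_wpM2l ?powR_ge0//.
  by rewrite ge0_ler_powR ?nnegrE// ltW.
Qed.

(** Bernoulli's inequality is applied to [rho^-1 = 1 + e]. *)
Lemma linear_le_geometric rho n : 0 < rho < 1 ->
  n.+3%:R * rho ^+ n <= 3 + (rho^-1 - 1)^-1.
Proof.
move=> /andP[r0 r1]; set e := rho^-1 - 1.
have e0 : 0 < e by rewrite subr_gt0 invf_gt1.
have bern : forall m, 1 + m%:R * e <= (1 + e) ^+ m.
  elim=> [|m IHm]; first by rewrite mul0r addr0 expr0.
  rewrite exprS -natr1 mulrDl mul1r.
  apply: le_trans (ler_wpM2l _ IHm); last by lra.
  have : 0 <= m%:R * e * e by rewrite !mulr_ge0// ltW.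
  by lra.
have -> : rho ^+ n = ((1 + e) ^+ n)^-1 by rewrite /e addrC subrK exprVn invrK.
rewrite ler_pdivrMr ?exprn_gt0//; last by lra.
have ee : e^-1 * e = 1 by rewrite mulVf// gt_eqF.
apply: le_trans (ler_wpM2l _ (bern n)); last by rewrite addr_ge0// invr_ge0 ltW.
have -> : n.+3%:R = n%:R + 3 :> R by rewrite -!natr1; ring.
have -> : (3 + e^-1) * (1 + n%:R * e) = 3 + 3 * (n%:R * e) + e^-1 + n%:R * (e^-1 * e) by ring.
rewrite ee mulr1; have : 0 <= e^-1 by rewrite invr_ge0 ltW.
have : 0 <= n%:R * e by rewrite mulr_ge0// ltW.
by lra.
Qed.

(* [kappa n] is [9 * 4 ^- n * slope n ^+ 2], the bound on the second-order
   variation of the level-[n] term. *)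
Definition kappa n : R := 48 ^+ 2 * n.+3%:R ^+ 4.

Lemma kappa_ge0 n : 0 <= kappa n.
Proof. by rewrite mulr_ge0// exprn_ge0. Qed.

Lemma series_geometric_le rho N : 0 < rho < 1 ->
  \sum_(0 <= i < N) rho ^+ i <= (1 - rho)^-1.
Proof.
move=> /andP[r0 r1]; have s0 : 0 < 1 - rho by rewrite subr_gt0.
rewrite -(ler_pM2r s0) mulVf ?gt_eqF//.
suff -> : (\sum_(0 <= i < N) rho ^+ i) * (1 - rho) = 1 - rho ^+ N.
  by rewrite lerBlDr lerDl exprn_ge0// ltW.
elim: N => [|N IHN]; first by rewrite big_nil expr0 mul0r subrr.
by rewrite big_nat_recr//= mulrDl IHN exprS; ring.
Qed.

(* The geometric decay in [n] of the interpolated bound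
   [kappa n * (2 ^- n) `^ (1 - a) * d `^ a] beats the polynomial [kappa]. *)
Lemma series_interp a : 0 < a < 1 -> exists2 C : R, 0 <= C &
  forall d c, 0 <= d -> (forall n, `|c n| <= kappa n * 2 ^- n) ->
  (forall n, `|c n| <= kappa n * d) ->
  forall N, `|series c N| <= C * d `^ a.
Proof.
move=> a01; have /andP[a0 a1] := a01.
(* A fifth root is taken so that the decay is [rho ^+ (5 * n)]: four factors [rho ^+ n] absorb the
   fourth power in [kappa], and the last one makes the series converge. *)
pose rho : R := 2^-1 `^ ((1 - a) / 5).
have rho0 : 0 < rho by rewrite powR_gt0.
have rho1 : rho < 1.
  have -> : 1 = 1 `^ ((1 - a) / 5) :> R by rewrite powR1.
  by rewrite gt0_ltr_powR ?nnegrE ?divr_gt0 ?subr_gt0//; lra.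
have rho01 : 0 < rho < 1 by rewrite rho0.
have powE n : (2 ^- n) `^ (1 - a) = rho ^+ (5 * n).
  have half0 : 0 <= 2^-1 :> R by [].
  rewrite -exprVn -(powR_mulrn n half0) -(powR_mulrn _ (ltW rho0)) /rho -!powRrM natrM.
  by congr (_ `^ _); field.
pose L := 3 + (rho^-1 - 1)^-1.
have L0 : 0 <= L.
  by rewrite addr_ge0// invr_ge0 subr_ge0 ltW// invf_gt1.
pose C := 48 ^+ 2 * L ^+ 4 * (1 - rho)^-1.
have C0 : 0 <= C.
  by rewrite !mulr_ge0 ?exprn_ge0// invr_ge0 subr_ge0 ltW.
exists C => // d c d0 c1 c2 N.
have cn n : `|c n| <= 48 ^+ 2 * L ^+ 4 * d `^ a * rho ^+ n.
  have k0 : 0 < kappa n by rewrite mulr_gt0// exprn_gt0.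
  have h : `|c n| / kappa n <= (2 ^- n) `^ (1 - a) * d `^ a.
    by apply: le_powR_interp => //; rewrite ?ler_pdivrMr ?(mulrC _ (kappa n))// invr_ge0 exprn_ge0.
  move: h; rewrite powE ler_pdivrMr// => /le_trans; apply.
  have -> : rho ^+ (5 * n) * d `^ a * kappa n =
      48 ^+ 2 * (n.+3%:R * rho ^+ n) ^+ 4 * d `^ a * rho ^+ n.
    rewrite /kappa exprMn -exprM (_ : (5 * n = n * 4 + n)%N); last by rewrite -mulnSr mulnC.
    by rewrite exprD; ring.
  apply: ler_wpM2r; first by rewrite exprn_ge0// ltW.
  apply: ler_wpM2r; first exact: powR_ge0.
  apply: ler_wpM2l => //.
  apply: lerXn2r; [by rewrite nnegrE mulr_ge0// exprn_ge0// ltW|by rewrite nnegrE|].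
  exact: linear_le_geometric.
rewrite /series /=; apply: le_trans (ler_norm_sum _ _ _) _.
apply: (@le_trans _ _ (\sum_(0 <= i < N) 48 ^+ 2 * L ^+ 4 * d `^ a * rho ^+ i)).
  by apply: ler_sum => i _; exact: cn.
rewrite -mulr_sumr /C.
have -> : 48 ^+ 2 * L ^+ 4 * (1 - rho)^-1 * d `^ a =
    48 ^+ 2 * L ^+ 4 * d `^ a * (1 - rho)^-1 by ring.
apply: ler_wpM2l; last exact: series_geometric_le.
by rewrite !mulr_ge0 ?exprn_ge0 ?powR_ge0.
Qed.

(** The partial sums of the absolute values are bounded by [series_interp] with [d = 1]. *)
Lemma is_cvg_series_kappa c : (forall n, `|c n| <= kappa n * 2 ^- n) ->
  cvgn (series c).
Proof.
move=> ck; apply: normed_cvg; suff : cvgn (series (fun n => `|c n|)) by [].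
have [|C C0 CP] := @series_interp 2^-1; first by lra.
have ub N : series (fun n => `|c n|) N <= C.
  have := CP 1 (fun n => `|c n|) ler01; rewrite powR1 /= mulr1.
  move=> /(_ _ _ N) h; apply: le_trans (ler_norm _) (h _ _) => n; rewrite normr_id//.
  rewrite mulr1; apply: le_trans (ck n) _; rewrite ler_piMr ?kappa_ge0//.
  by rewrite invf_le1 ?exprn_gt0// exprn_ege1// ler1n.
apply: nondecreasing_is_cvgn; last by exists C => _ [N _ <-]; exact: ub.
by apply/nondecreasing_seqP => n; rewrite seriesSr lerDl.
Qed.

Lemma norm_cvgn_le (u : nat -> R) (l M : R) : u @ \oo --> l ->
  (forall n, `|u n| <= M) -> `|l| <= M.
Proof.
move=> /cvg_norm ul uM; rewrite -(cvg_lim _ ul)//.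
by apply: limr_le; [exact: cvgP ul|near=> n].
Unshelve. all: by end_near. Qed.

Lemma limn_series_eventually0 c M : (forall n, (M <= n)%N -> c n = 0) ->
  limn (series c) = series c M.
Proof.
move=> c0; apply: cvg_lim => //.
have E N : (M <= N)%N -> series c N = series c M.
  elim: N => [|N IHN]; first by rewrite leqn0 => /eqP ->.
  rewrite leq_eqVlt => /predU1P[->//|]; rewrite ltnS => MN.
  by rewrite seriesSr c0// addr0 IHN.
apply: cvg_near_cst; exists M => // N /= MN; exact: E.
Qed.

End Interpolation.

(** * The function and its gradient *)

Section ProductTaylor.
Variable R : realType.
Variables (A : R) (a da b db : R -> R).
Hypotheses (aT : taylor2 A (A ^+ 2) a da) (bT : taylor2 A (A ^+ 2) b db).
Hypotheses (a1 : forall x, `|a x| <= 1) (b1 : forall x, `|b x| <= 1).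

Let A0 : 0 <= A.
Proof. by have [h _ _] := aT; rewrite (le_trans _ (h 0)). Qed.

Let norm_mul_le (u v M N : R) : `|u| <= M -> `|v| <= N -> `|u * v| <= M * N.
Proof. by move=> uM vN; rewrite normrM ler_pM. Qed.

Lemma prod_grad_bound x y : `|da x * b y| <= A.
Proof. by rewrite -[leRHS]mulr1 norm_mul_le//; case: aT. Qed.

Lemma prod_grad_lip x y x' y' (d : R) : `|x' - x| <= d -> `|y' - y| <= d ->
  `|da x' * b y' - da x * b y| <= 3 * A ^+ 2 * d.
Proof.
move=> xd yd.
have -> : da x' * b y' - da x * b y = (da x' - da x) * b y' + da x * (b y' - b y) by ring.
have -> : 3 * A ^+ 2 * d = (2 * A ^+ 2 * d) * 1 + A * (A * d) by ring.
apply: le_trans (ler_normD _ _) (lerD _ _); apply: norm_mul_le => //.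
- by apply: le_trans (taylor2_lip _ _ aT) _; rewrite ler_wpM2l// mulr_ge0// sqr_ge0.
- by case: aT.
- by have [_ h _] := bT; apply: le_trans (h _ _) _; rewrite ler_wpM2l.
Qed.

Lemma prod_rem2 x y x' y' (d : R) : `|x' - x| <= d -> `|y' - y| <= d ->
  `|a x' * b y' - a x * b y - (da x * b y * (x' - x) + a x * db y * (y' - y))|
  <= 3 * A ^+ 2 * d * d.
Proof.
move=> xd yd; have [_ aL aR] := aT; have [_ bL bR] := bT.
have -> : a x' * b y' - a x * b y - (da x * b y * (x' - x) + a x * db y * (y' - y)) =
   b y * (a x' - a x - da x * (x' - x)) + a x * (b y' - b y - db y * (y' - y)) +
   (a x' - a x) * (b y' - b y) by ring.
have -> : 3 * A ^+ 2 * d * d = 1 * (A ^+ 2 * d ^+ 2) + 1 * (A ^+ 2 * d ^+ 2) +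
  (A * d) * (A * d) by ring.
have sq (u : R) : `|u| <= d -> A ^+ 2 * u ^+ 2 <= A ^+ 2 * d ^+ 2.
  move=> ud; rewrite ler_wpM2l ?sqr_ge0//.
  by rewrite -(real_normK (num_real u)) lerXn2r ?nnegrE// (le_trans _ ud).
apply: le_trans (ler_normD _ _) (lerD (le_trans (ler_normD _ _) (lerD _ _)) _);
  apply: norm_mul_le => //.
- exact: le_trans (aR _ _) (sq _ xd).
- exact: le_trans (bR _ _) (sq _ yd).
- by apply: le_trans (aL _ _) _; rewrite ler_wpM2l.
- by apply: le_trans (bL _ _) _; rewrite ler_wpM2l.
Qed.

(** This cruder bound is the better one for distant points, [prod_rem2] for close ones; the
    interpolation takes both as input. *)
Lemma prod_rem1 x y x' y' (d : R) : `|x' - x| <= d -> `|y' - y| <= d ->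
  `|a x' * b y' - a x * b y - (da x * b y * (x' - x) + a x * db y * (y' - y))|
  <= 4 * A * d.
Proof.
move=> xd yd; have [aD aL _] := aT; have [bD bL _] := bT.
have -> : a x' * b y' - a x * b y - (da x * b y * (x' - x) + a x * db y * (y' - y)) =
   (a x' - a x) * b y' + a x * (b y' - b y) - (da x * b y * (x' - x) + a x * db y * (y' - y))
   by ring.
have -> : 4 * A * d = (A * d * 1 + 1 * (A * d)) + (A * 1 * d + 1 * A * d) by ring.
apply: le_trans (ler_normB _ _) (lerD _ _).
  apply: le_trans (ler_normD _ _) (lerD _ _); apply: norm_mul_le => //.
    by apply: le_trans (aL _ _) _; rewrite ler_wpM2l.
  by apply: le_trans (bL _ _) _; rewrite ler_wpM2l.
apply: le_trans (ler_normD _ _) (lerD _ _); apply: norm_mul_le => //; exact: norm_mul_le.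
Qed.

End ProductTaylor.

(** * The series, its termwise gradient and the bounds at each level *)

Section Construction.
Variable R : realType.
Implicit Types (X Y : R * R) (n : nat) (d : R).

Definition fterm n X : R :=
  4 ^- n * ((2 * sgf n X.1 + sgf n X.2) * (cell n X.1 * cell n X.2)).
(** The signs are differentiated as constants: they jump only where the cells of their coordinate
    vanish together with their slopes. *)
Definition dterm1 n X : R :=
  4 ^- n * ((2 * sgf n X.1 + sgf n X.2) * (dcell n X.1 * cell n X.2)).
Definition dterm2 n X : R :=
  4 ^- n * ((2 * sgf n X.1 + sgf n X.2) * (cell n X.1 * dcell n X.2)).

Definition fcounter X : R := limn (series (fterm^~ X)).
Definition dcounter1 X : R := limn (series (dterm1^~ X)).
Definition dcounter2 X : R := limn (series (dterm2^~ X)).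

Definition rterm n X Y : R := fterm n Y - fterm n X -
  (dterm1 n X * (Y.1 - X.1) + dterm2 n X * (Y.2 - X.2)).

Let cT n := taylor2_cell R n.
Let sT n := taylor2_sgcell R n.
Let c1 n (x : R) : `|cell n x| <= 1 := cell_norm_le1 n x.
Let s1 n (x : R) : `|sgf n x * cell n x| <= 1.
Proof. by rewrite normrM mulr_ile1// ?sgf_norm_le1 ?cell_norm_le1. Qed.

Let comb_le n (p q M : R) : `|p| <= M -> `|q| <= M ->
  `|4 ^- n * (2 * p + q)| <= 3 * 4 ^- n * M.
Proof.
move=> pM qM; have p0 : 0 <= 4 ^- n :> R by rewrite invr_ge0 exprn_ge0.
rewrite normrM (ger0_norm p0) (mulrC 3) -mulrA ler_wpM2l//.
apply: le_trans (ler_normD _ _) _; rewrite normrM ger0_norm//; lra.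
Qed.

Let four_slope n : 4 ^- n * slope R n = 16 * n.+3%:R ^+ 2 * 2 ^- n.
Proof.
rewrite /slope -exprVn (_ : 4^-1 = 2^-1 * 2^-1 :> R); last by field.
rewrite exprMn exprVn.
have p0 : 0 < 2 ^+ n :> R by rewrite exprn_gt0.
by field; rewrite gt_eqF.
Qed.

Let kappa1 n : 3 * 4 ^- n * (4 * slope R n) <= kappa R n * 2 ^- n.
Proof.
have -> : 3 * 4 ^- n * (4 * slope R n) = 12 * (4 ^- n * slope R n) by ring.
rewrite four_slope mulrA ler_wpM2r ?invr_ge0 ?exprn_ge0// /kappa.
have : 1 <= n.+3%:R ^+ 2 :> R by rewrite exprn_ege1// ler1n.
rewrite (exprM _ 2 2); move: (n.+3%:R ^+ 2) => c cc1.
have : 0 <= c * (c - 1) by rewrite mulr_ge0; lra.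
by nra.
Qed.

Let kappa2 n : 3 * 4 ^- n * (3 * slope R n ^+ 2) = kappa R n.
Proof.
have -> : 3 * 4 ^- n * (3 * slope R n ^+ 2) = 9 * (4 ^- n * slope R n) * slope R n by ring.
rewrite four_slope /slope /kappa.
have p0 : 0 < 2 ^+ n :> R by rewrite exprn_gt0.
by field; rewrite gt_eqF.
Qed.

Lemma slope_ge0 n : 0 <= slope R n.
Proof. by rewrite !mulr_ge0 ?exprn_ge0. Qed.

Lemma fterm_bound n X : `|fterm n X| <= 3 * 4 ^- n.
Proof.
rewrite -[leRHS]mulr1 /fterm.
have -> : (2 * sgf n X.1 + sgf n X.2) * (cell n X.1 * cell n X.2) =
  2 * ((sgf n X.1 * cell n X.1) * cell n X.2) +
      (cell n X.1 * (sgf n X.2 * cell n X.2)) by ring.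
by apply: comb_le; rewrite normrM mulr_ile1.
Qed.

(** Each sign is attached to the cell of its own coordinate, because [taylor2_sgcell] controls the
    product whereas the sign alone is discontinuous. *)
Lemma dterm1E n X : dterm1 n X = 4 ^- n *
  (2 * ((sgf n X.1 * dcell n X.1) * cell n X.2) +
      (dcell n X.1 * (sgf n X.2 * cell n X.2))).
Proof. by rewrite /dterm1; ring. Qed.

Lemma dterm2E n X : dterm2 n X = 4 ^- n *
  (2 * (dcell n X.2 * (sgf n X.1 * cell n X.1)) +
      ((sgf n X.2 * dcell n X.2) * cell n X.1)).
Proof. by rewrite /dterm2; ring. Qed.

Lemma rtermE n X Y : rterm n X Y = 4 ^- n *
  (2 * ((sgf n Y.1 * cell n Y.1) * cell n Y.2 - (sgf n X.1 * cell n X.1) * cell n X.2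
        - ((sgf n X.1 * dcell n X.1) * cell n X.2 * (Y.1 - X.1)
           + (sgf n X.1 * cell n X.1) * dcell n X.2 * (Y.2 - X.2))) +
   (cell n Y.1 * (sgf n Y.2 * cell n Y.2) - cell n X.1 * (sgf n X.2 * cell n X.2)
        - (dcell n X.1 * (sgf n X.2 * cell n X.2) * (Y.1 - X.1)
           + cell n X.1 * (sgf n X.2 * dcell n X.2) * (Y.2 - X.2)))).
Proof. by rewrite /rterm /fterm /dterm1 /dterm2; ring. Qed.

Let slope_kappa n : 3 * 4 ^- n * slope R n <= kappa R n * 2 ^- n.
Proof.
apply: le_trans (kappa1 n); rewrite ler_wpM2l ?mulr_ge0 ?invr_ge0 ?exprn_ge0//.
by have := slope_ge0 n; lra.
Qed.

Lemma dterm1_bound n X : `|dterm1 n X| <= 3 * 4 ^- n * slope R n.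
Proof.
by rewrite dterm1E; apply: comb_le;
  [exact: (prod_grad_bound (sT n) (c1 n))|exact: (prod_grad_bound (cT n) (s1 n))].
Qed.

Lemma dterm2_bound n X : `|dterm2 n X| <= 3 * 4 ^- n * slope R n.
Proof.
by rewrite dterm2E; apply: comb_le;
  [exact: (prod_grad_bound (cT n) (s1 n))|exact: (prod_grad_bound (sT n) (c1 n))].
Qed.

Lemma kappa_diff n (u v : R) : `|u| <= 3 * 4 ^- n * slope R n ->
  `|v| <= 3 * 4 ^- n * slope R n -> `|u - v| <= kappa R n * 2 ^- n.
Proof.
move=> hu hv; apply: le_trans (ler_normB _ _) (le_trans (lerD hu hv) (le_trans _ (kappa1 n))).
rewrite -mulrDr ler_wpM2l ?mulr_ge0 ?invr_ge0 ?exprn_ge0//.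
by have := slope_ge0 n; lra.
Qed.

Lemma dterm1_lip n X Y d : `|Y.1 - X.1| <= d -> `|Y.2 - X.2| <= d ->
  `|dterm1 n Y - dterm1 n X| <= kappa R n * d.
Proof.
move=> d1 d2; rewrite -kappa2 -[leRHS]mulrA !dterm1E -mulrBr.
rewrite (_ : _ - _ = 2 * ((sgf n Y.1 * dcell n Y.1) * cell n Y.2 -
   (sgf n X.1 * dcell n X.1) * cell n X.2) + (dcell n Y.1 * (sgf n Y.2 * cell n Y.2) -
   dcell n X.1 * (sgf n X.2 * cell n X.2))); last by ring.
apply: comb_le.
- exact: (prod_grad_lip (sT n) (cT n) (c1 n)).
- exact: (prod_grad_lip (cT n) (sT n) (s1 n)).
Qed.

Lemma dterm2_lip n X Y d : `|Y.1 - X.1| <= d -> `|Y.2 - X.2| <= d ->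
  `|dterm2 n Y - dterm2 n X| <= kappa R n * d.
Proof.
move=> d1 d2; rewrite -kappa2 -[leRHS]mulrA !dterm2E -mulrBr.
rewrite (_ : _ - _ = 2 * (dcell n Y.2 * (sgf n Y.1 * cell n Y.1) -
   dcell n X.2 * (sgf n X.1 * cell n X.1)) + ((sgf n Y.2 * dcell n Y.2) * cell n Y.1 -
   (sgf n X.2 * dcell n X.2) * cell n X.1)); last by ring.
apply: comb_le.
- exact: (prod_grad_lip (cT n) (sT n) (s1 n)).
- exact: (prod_grad_lip (sT n) (cT n) (c1 n)).
Qed.

Lemma rterm_bound1 n X Y d : `|Y.1 - X.1| <= d -> `|Y.2 - X.2| <= d ->
  `|rterm n X Y| <= kappa R n * 2 ^- n * d.
Proof.
move=> d1 d2; have d0 := le_trans (normr_ge0 _) d1.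
apply: le_trans (ler_wpM2r d0 (kappa1 n)); rewrite -[leRHS]mulrA rtermE.
apply: comb_le.
- exact: (prod_rem1 (sT n) (cT n) (s1 n) (c1 n)).
- exact: (prod_rem1 (cT n) (sT n) (c1 n) (s1 n)).
Qed.

Lemma rterm_bound2 n X Y d : `|Y.1 - X.1| <= d -> `|Y.2 - X.2| <= d ->
  `|rterm n X Y| <= kappa R n * d * d.
Proof.
move=> d1 d2; rewrite rtermE -kappa2.
have -> : 3 * 4 ^- n * (3 * slope R n ^+ 2) * d * d =
  3 * 4 ^- n * (3 * slope R n ^+ 2 * d * d) by ring.
apply: comb_le.
- exact: (prod_rem2 (sT n) (cT n) (s1 n) (c1 n)).
- exact: (prod_rem2 (cT n) (sT n) (c1 n) (s1 n)).
Qed.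

Lemma fcounter_cvg X : series (fterm^~ X) @ \oo --> fcounter X.
Proof.
apply: is_cvg_series_kappa => n; apply: le_trans (fterm_bound n X) _.
apply: le_trans (slope_kappa n); rewrite ler_peMr ?mulr_ge0 ?invr_ge0 ?exprn_ge0//.
rewrite /slope mulr_ege1// ?mulr_ege1 ?exprn_ege1// ?ler1n//.
Qed.

Lemma dcounter1_cvg X : series (dterm1^~ X) @ \oo --> dcounter1 X.
Proof.
by apply: is_cvg_series_kappa => n; apply: le_trans (dterm1_bound n X) (slope_kappa n).
Qed.

Lemma dcounter2_cvg X : series (dterm2^~ X) @ \oo --> dcounter2 X.
Proof.
by apply: is_cvg_series_kappa => n; apply: le_trans (dterm2_bound n X) (slope_kappa n).
Qed.

Lemma dcounter_holder (a : R) : 0 < a < 1 -> exists2 C : R, 0 <= C &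
  forall X Y d, `|Y.1 - X.1| <= d -> `|Y.2 - X.2| <= d ->
  `|dcounter1 Y - dcounter1 X| <= C * d `^ a /\
  `|dcounter2 Y - dcounter2 X| <= C * d `^ a.
Proof.
move=> a01; have [C C0 CP] := series_interp a01.
exists C => // X Y d d1 d2; have d0 := le_trans (normr_ge0 _) d1; split.
- apply: (norm_cvgn_le (cvgB (dcounter1_cvg (X := Y)) (dcounter1_cvg (X := X)))) => N /=.
  suff : `|series (fun n => dterm1 n Y - dterm1 n X) N| <= C * d `^ a.
    by rewrite /series /= sumrB.
  apply: CP => // n; last exact: dterm1_lip.
  by apply: kappa_diff; exact: dterm1_bound.
- apply: (norm_cvgn_le (cvgB (dcounter2_cvg (X := Y)) (dcounter2_cvg (X := X)))) => N /=.
  suff : `|series (fun n => dterm2 n Y - dterm2 n X) N| <= C * d `^ a.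
    by rewrite /series /= sumrB.
  apply: CP => // n; last exact: dterm2_lip.
  by apply: kappa_diff; exact: dterm2_bound.
Qed.

(** The exponent 1/2 is one choice in (0,1): for differentiability the factor in front of [d] only
    has to tend to 0 with [d]. *)
Lemma fcounter_taylor : exists2 C : R, 0 <= C &
  forall X Y d, 0 < d -> `|Y.1 - X.1| <= d -> `|Y.2 - X.2| <= d ->
  `|fcounter Y - fcounter X -
    (dcounter1 X * (Y.1 - X.1) + dcounter2 X * (Y.2 - X.2))| <= C * d `^ 2^-1 * d.
Proof.
have [|C C0 CP] := @series_interp R 2^-1; first by lra.
exists C => // X Y d d0 d1 d2.
have L : series (fterm^~ Y) N - series (fterm^~ X) N -
    (series (dterm1^~ X) N * (Y.1 - X.1) + series (dterm2^~ X) N * (Y.2 - X.2))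
    @[N --> \oo] --> fcounter Y - fcounter X -
    (dcounter1 X * (Y.1 - X.1) + dcounter2 X * (Y.2 - X.2)).
  apply: cvgB; first by apply: cvgB; exact: fcounter_cvg.
  by apply: cvgD; apply: cvgMr_tmp; [exact: dcounter1_cvg|exact: dcounter2_cvg].
apply: (norm_cvgn_le L) => N /=.
(* After division by [d], [rterm_bound1] and [rterm_bound2] become the two hypotheses of
   [series_interp]. *)
suff : `|series (fun n => rterm n X Y / d) N| <= C * d `^ 2^-1.
  rewrite /series /= -mulr_suml normrM normfV (gtr0_norm d0) ler_pdivrMr//.
  by rewrite /rterm !(sumrB, big_split) /= -!mulr_suml.
apply: CP => [|n|n]; first exact: ltW.
- rewrite normrM normfV (gtr0_norm d0) ler_pdivrMr//; exact: rterm_bound1.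
- rewrite normrM normfV (gtr0_norm d0) ler_pdivrMr//; exact: rterm_bound2.
Qed.

End Construction.

(** * Differentiability and Hoelder continuity of the gradient *)

Section Differentiability.
Variable R : realType.
Implicit Types (X Y : R * R) (d : R).

Definition lin2 (p q : R) (v : R * R) : R := p * v.1 + q * v.2.

Lemma lin2_is_linear p q : linear (lin2 p q).
Proof.
by move=> k u v; rewrite /lin2 /= -[k *: (p * _ + _)]/(k * (p * _ + _)) /GRing.scale/=; ring.
Qed.

HB.instance Definition _ p q :=
  GRing.isLinear.Build R (R * R)%type R *:%R (lin2 p q) (lin2_is_linear p q).

Lemma lin2_continuous p q : continuous (lin2 p q).
Proof.
move=> X; apply: cvgD; apply: cvgM; try exact: cvg_cst; [exact: cvg_fst|exact: cvg_snd].
Qed.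

Lemma diff_of_taylor (f : R * R -> R) X p q (C : R) : 0 <= C ->
  (forall Y d, 0 < d -> `|Y.1 - X.1| <= d -> `|Y.2 - X.2| <= d ->
    `|f Y - f X - (p * (Y.1 - X.1) + q * (Y.2 - X.2))| <= C * d `^ 2^-1 * d) ->
  differentiable f X /\ 'd f X = lin2 p q :> (R * R -> R).
Proof.
move=> C0 fT.
have lo : f \o shift X = cst (f X) + lin2 p q +o_ (0 : R * R) id.
  apply/eqaddoP => e e0.
  (* The square root of [D] is [e / (C + 1)], and [C] times this is at most [e]; adding 1 covers
     [C = 0]. *)
  pose D := (e / (C + 1)) ^+ 2.
  have C1 : 0 < C + 1 by lra.
  have D0 : 0 < D by rewrite exprn_gt0// divr_gt0.
  near=> h; rewrite /= !fctE /=.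
  have [->|h0] := eqVneq h 0.
    by rewrite add0r /lin2 /= !mulr0 addr0 addr0 subrr !normr0 mulr0.
  have hgt : 0 < `|h| by rewrite normr_gt0.
  have h1 : `|h.1| <= `|h| by rewrite [leRHS]prod_normE le_max lexx.
  have h2 : `|h.2| <= `|h| by rewrite [leRHS]prod_normE le_max lexx orbT.
  have := fT (h + X) `|h| hgt; rewrite /= !addrK => /(_ h1 h2) hT.
  suff : `|f (h + X) - f X - (p * h.1 + q * h.2)| <= e * `|h|.
    by rewrite -[X in _ -> `|_ - X| <= _]/(f X + lin2 p q h) (opprD (f X) (lin2 p q h)) addrA.
  apply: le_trans hT _; rewrite ler_wpM2r//.
    have hD : `|h| <= D.
      by apply: ltW; near: h; exact: (@nbhs0_lt R (R * R)%type D D0).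
    have : `|h| `^ 2^-1 <= D `^ 2^-1.
      by rewrite ge0_ler_powR ?nnegrE// ltW.
    have -> : D `^ 2^-1 = e / (C + 1).
      rewrite powR12_sqrt ?ltW// sqrtr_sqr ger0_norm// ltW// divr_gt0//.
    move=> /(ler_wpM2l C0)/le_trans; apply.
    by rewrite mulrA ler_pdivrMr// mulrC ler_wpM2l ?ltW//; lra.
have dE := diff_unique (@lin2_continuous p q) lo.
split=> //; apply/diff_locallyP; rewrite dE; split => //; exact: lin2_continuous.
Unshelve. all: by end_near. Qed.

Lemma fcounter_diff X : differentiable (@fcounter R) X /\
  'd (@fcounter R) X = lin2 (dcounter1 X) (dcounter2 X) :> (R * R -> R).
Proof.
by have [C C0 CP] := fcounter_taylor R; apply: (diff_of_taylor C0) => Y d; exact: CP.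
Qed.

Lemma gradE X : grad (@fcounter R) X = (dcounter1 X, dcounter2 X).
Proof.
by rewrite /grad (fcounter_diff X).2 /lin2 /= !mulr1 !mulr0 addr0 add0r.
Qed.

Lemma fcounter_continuous : continuous (@fcounter R).
Proof. by move=> X; exact/differentiable_continuous/(fcounter_diff X).1. Qed.

Lemma edist_le (X Y : R * R) : Defs.edist X Y <= `|X.1 - Y.1| + `|X.2 - Y.2|.
Proof.
rewrite /Defs.edist -[leRHS]ger0_norm ?addr_ge0// -sqrtr_sqr ler_wsqrtr//.
by rewrite [leRHS]sqrrD !real_normK ?num_real// lerD2r lerDl mulrn_wge0//.
Qed.

Lemma edist_ge1 (X Y : R * R) : `|X.1 - Y.1| <= Defs.edist X Y.
Proof. by rewrite /Defs.edist -sqrtr_sqr ler_wsqrtr// lerDl sqr_ge0. Qed.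

Lemma edist_ge2 (X Y : R * R) : `|X.2 - Y.2| <= Defs.edist X Y.
Proof. by rewrite /Defs.edist -sqrtr_sqr ler_wsqrtr// lerDr sqr_ge0. Qed.

Lemma fcounter_C1alpha : C1alpha_all (@fcounter R).
Proof.
split; first exact/continuous_subspaceT/fcounter_continuous.
split=> [X _|a a01]; first exact: (fcounter_diff X).1.
have [C C0 CP] := @dcounter_holder R _ a01.
exists (2 * C) => X Y _ _; rewrite !gradE.
have [h1 h2] := CP Y X _ (edist_ge1 X Y) (edist_ge2 X Y).
apply: le_trans (edist_le _ _) _; rewrite /= -mulrA mulr_natl mulr2n.
exact: lerD.
Qed.

Lemma crit_fcounter X : crit (@fcounter R) X <->
  [/\ square X, dcounter1 X = 0 & dcounter2 X = 0].
Proof.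
split=> [[sX]|[sX d1 d2]]; last first.
  split=> //; right => v; rewrite (fcounter_diff X).2 /lin2 d1 d2.
  by rewrite !mul0r addr0.
move=> [/(_ (fcounter_diff X).1)//|d0].
have := d0 (1, 0); have := d0 (0, 1); rewrite (fcounter_diff X).2 /lin2 /=.
by rewrite !mulr1 !mulr0 addr0 add0r.
Qed.

End Differentiability.

(** * Critical values and components of level sets *)

Section Cantor.
Variable R : realType.
Implicit Types (X Y : R * R) (x y : R) (n m k : nat).

Definition cantor : set R := [set x | forall n, `|fold n x| <= hw R n].

Lemma cantor_square X : (cantor `*` cantor) X -> square X.
Proof.
move=> [/= /(_ 0%N) /= + /(_ 0%N) /=]; rewrite hw0 !ler_norml.
by move=> /andP[? ?] /andP[? ?]; split; apply/andP; split; lra.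
Qed.

(** On the Cantor square every cell is on its plateau, so each term of the gradient vanishes. *)
Lemma cantor_crit : cantor `*` cantor `<=` crit (@fcounter R).
Proof.
move=> X KX; have [K1 K2] := KX; apply/crit_fcounter; split; first exact: cantor_square.
- rewrite /dcounter1 (@limn_series_eventually0 _ _ 0); first by rewrite /series /= big_nil.
  by move=> n _; rewrite /dterm1 (dcell_in (ltnSn n.+1) (K1 n.+2)) mul0r !mulr0.
- rewrite /dcounter2 (@limn_series_eventually0 _ _ 0); first by rewrite /series /= big_nil.
  by move=> n _; rewrite /dterm2 (dcell_in (ltnSn n.+1) (K2 n.+2)) !mulr0.
Qed.

Lemma sgr_ratr x : exists q : rat, Num.sg x = ratr q.
Proof.
case: sgrP => _; [exists 0|exists 1|exists (-1)]; by rewrite ?rmorph0 ?rmorph1 ?rmorphN1.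
Qed.

Lemma series_fterm_ratr X M :
  (forall n, (n < M)%N -> cell n X.1 = 1 /\ cell n X.2 = 1) ->
  exists q : rat, series (@fterm R ^~ X) M = ratr q.
Proof.
elim: M => [|M IHM] c1; first by exists 0; rewrite /series /= big_nil rmorph0.
have [|q qE] := IHM; first by move=> n nM; apply: c1; rewrite ltnS ltnW.
have [q1 q1E] := sgr_ratr (fold M X.1); have [q2 q2E] := sgr_ratr (fold M X.2).
have [e1 e2] := c1 M (ltnSn M).
exists (q + 4 ^- M * (2 * q1 + q2)).
rewrite seriesSr qE /fterm /sgf q1E q2E e1 e2 !mulr1.
by rewrite rmorphD rmorphM fmorphV rmorphXn !rmorph_nat rmorphD (rmorphM _ 2) rmorph_nat.
Qed.

(** This serves both the critical points off the Cantor square and the boundaries of the nested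
    squares: finitely many plateau heights, then nothing. *)
Lemma fcounter_ratr X M :
  (forall n, (n < M)%N -> cell n X.1 = 1 /\ cell n X.2 = 1) ->
  (forall n, (M <= n)%N -> fterm n X = 0) ->
  exists q : rat, fcounter X = ratr q.
Proof.
move=> c1 f0; have [q qE] := series_fterm_ratr c1; exists q.
by rewrite /fcounter (limn_series_eventually0 f0).
Qed.

Lemma cell_dead n k x : hw R n <= `|fold n x| -> (n <= k.+1)%N ->
  cell k x = 0 /\ dcell k x = 0.
Proof.
move=> hx; rewrite leq_eqVlt => nk.
have hk : hw R k.+1 <= `|fold k.+1 x|.
  case/predU1P: nk => [<-//|nk]; apply: le_trans (ler_norm _).
  exact: ltW (fold_dead_le nk hx).
by rewrite cell_out ?dcell_out.
Qed.

Lemma fold_dead_transition n x : hw R n.+1 < `|fold n.+1 x| -> 2 * hw R n.+1 < `|fold n x|.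
Proof.
rewrite ltNge ler_norml negb_and -!ltNge /= => /orP[|]; last by lra.
by have := normr_ge0 (fold n x); lra.
Qed.

(** Alive at [m.+1] and dead at [m.+2], the point is either on the boundary, where the bump is zero,
    or strictly in the transition zone, where its slope is not; then the other factor must
    vanish. *)
Lemma grad_factor_eq0 m x y : hw R m.+2 < `|fold m.+2 x| -> `|fold m.+1 x| <= hw R m.+1 ->
  dcell m x * cell m y = 0 -> cell m x * cell m y = 0.
Proof.
move=> dead; rewrite le_eqVlt => /predU1P[h|h] dc.
  by rewrite cell_out ?mul0r// h.
have : dcell m x != 0 by rewrite dcell_neq0// h andbT fold_dead_transition.
by move: dc => /eqP; rewrite mulf_eq0 => /orP[->//|/eqP ->]; rewrite mulr0.
Qed.

(* Outside the Cantor set the gradient is carried by a single term, whose bump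
   has nonzero slope in the transition zone: a critical value there is a finite
   sum of rationals. *)
Lemma crit_cantor_or_ratr X : crit (@fcounter R) X ->
  (cantor `*` cantor) X \/ exists q : rat, fcounter X = ratr q.
Proof.
move=> /crit_fcounter[[/andP[s1 s1'] /andP[s2 s2']] d1 d2].
pose P n := ~~ ((`|fold n X.1| <= hw R n) && (`|fold n X.2| <= hw R n)).
have [exP|nexP] := pselect (exists n, P n); last first.
  left; split => /= n; apply: contrapT => /negP hn; apply: nexP; exists n;
    by rewrite /P (negbTE hn) ?andbF.
right; have [n Pn nmin] := ex_minnP exP.
have alive k : (k < n)%N -> (`|fold k X.1| <= hw R k) && (`|fold k X.2| <= hw R k).
  by rewrite ltnNge; apply: contraNT; exact: nmin.
case: n => [|m] in Pn nmin alive *.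
  move: Pn; rewrite /P /= hw0 !ler_norml; case/negP.
  by apply/andP; split; apply/andP; split; lra.
have dead : (hw R m.+1 < `|fold m.+1 X.1|) || (hw R m.+1 < `|fold m.+1 X.2|).
  by move: Pn; rewrite /P negb_and -!ltNge.
have f0 k : (m <= k)%N -> fterm k X = 0 /\ (dterm1 k X = 0 /\ dterm2 k X = 0).
  move=> mk; have mk' : (m.+1 <= k.+1)%N by [].
  rewrite /fterm /dterm1 /dterm2.
  by case/orP: dead => /ltW /cell_dead/(_ mk')[-> ->]; rewrite !(mul0r,mulr0).
(* If the first dead level is 1, all terms vanish. Otherwise it is [m.+2]: terms before [m] are on
   their plateaus, terms after [m] vanish, and [m] alone carries the gradient. *)
case: m => [|m] in Pn nmin alive dead f0 *.
  by apply: (@fcounter_ratr _ 0) => // k /f0[].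
have /andP[al1 al2] := alive m.+1 (ltnSn _).
have pre k : (k < m)%N -> (cell k X.1 = 1 /\ cell k X.2 = 1) /\
    (dcell k X.1 = 0 /\ dcell k X.2 = 0).
  by move=> km; rewrite !(@cell_in _ _ m.+1)// !(@dcell_in _ _ m.+1).
apply: (@fcounter_ratr _ m) => [k /pre[]//|k].
rewrite leq_eqVlt => /predU1P[<-|/f0[]//].
have e1 : dterm1 m X = 0.
  rewrite -d1 /dcounter1 (@limn_series_eventually0 _ _ m.+1); last by move=> j /f0[_ []].
  rewrite seriesSr /series /= big_nat_cond big1 ?add0r// => i /andP[/andP[_ im] _].
  by rewrite /dterm1 (pre i im).2.1 mul0r !mulr0.
have e2 : dterm2 m X = 0.
  rewrite -d2 /dcounter2 (@limn_series_eventually0 _ _ m.+1); last by move=> j /f0[_ []].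
  rewrite seriesSr /series /= big_nat_cond big1 ?add0r// => i /andP[/andP[_ im] _].
  by rewrite /dterm2 (pre i im).2.2 !mulr0.
have p0 : 4 ^- m != 0 :> R by rewrite invr_neq0// expf_neq0.
move: e1 e2; rewrite /fterm /dterm1 /dterm2.
move=> /eqP; rewrite mulf_eq0 (negbTE p0) /= mulf_eq0 => /orP[/eqP->|/eqP e1].
  by rewrite !(mul0r, mulr0).
move=> /eqP; rewrite mulf_eq0 (negbTE p0) /= mulf_eq0 => /orP[/eqP->|/eqP e2].
  by rewrite mul0r mulr0.
suff -> : cell m X.1 * cell m X.2 = 0 by rewrite !mulr0.
case/orP: dead => dead; first exact: (grad_factor_eq0 dead).
by rewrite mulrC; apply: (grad_factor_eq0 dead) => //; rewrite mulrC.
Qed.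

(** * Level-set components through the Cantor square *)

Lemma sgr_eq_of_mul_gt0 x y : 0 < y * x -> Num.sg x = Num.sg y.
Proof.
by case: (sgrP x) => x0; case: (sgrP y) => y0 //; rewrite ?x0 ?y0 ?mul0r ?mulr0 ?ltxx// => h;
  exfalso; nra.
Qed.

Lemma connected_same_sign (T : topologicalType) (A : set T) (g : T -> R) (a b : T) :
  connected A -> continuous g -> (forall c, A c -> g c != 0) -> A a -> A b ->
  0 < g a * g b.
Proof.
move=> cA cg g0 Aa Ab.
have /connected_intervalP ig : connected (g @` A).
  by apply: connected_continuous_connected => //; exact: continuous_subspaceT.
have no0 u v : A u -> A v -> g u <= 0 <= g v -> False.
  move=> Au Av uv; have [c Ac /eqP] : (g @` A) 0.
    by apply: (ig (g u) (g v)) => //.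
  by apply/negP; exact: g0.
have := g0 _ Aa; have := g0 _ Ab; rewrite !neq_lt => /orP[b0|b0] /orP[a0|a0].
- by rewrite nmulr_rgt0.
- by have := no0 _ _ Ab Aa; rewrite !ltW// => /(_ isT).
- by have := no0 _ _ Aa Ab; rewrite !ltW// => /(_ isT).
- by rewrite mulr_gt0.
Qed.

Lemma fold_continuous n : continuous (@fold R n).
Proof.
elim: n => [|n IHn] x /=; first by apply: cvgB; [exact: cvg_id|exact: cvg_cst].
by apply: cvgB; [apply: cvg_norm; exact: IHn|exact: cvg_cst].
Qed.

(** Absolute values preserve the distance of two numbers of equal sign. *)
Lemma fold_isometry n x y : (forall m, (m < n)%N -> sgf m x = sgf m y) ->
  `|fold n x - fold n y| = `|x - y|.
Proof.
elim: n => [|n IHn] sxy /=; first by rewrite opprB addrA subrK.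
rewrite -IHn; last by move=> m mn; apply: sxy; rewrite ltnS ltnW.
have := sxy n (ltnSn n); rewrite /sgf.
move: (fold n x) (fold n y) => u v suv.
rewrite opprB addrA subrK.
have [u0|u0] := eqVneq u 0.
  by move: suv; rewrite u0 sgr0 => /esym/eqP; rewrite sgr_eq0 => /eqP ->; rewrite !subrr.
rewrite (normrEsg u) (normrEsg v) suv -mulrBr normrM -suv normr_sg u0 mul1r//.
Qed.

Lemma cantor_dist n x y : `|fold n x| <= hw R n -> `|fold n y| <= hw R n ->
  (forall m, (m < n)%N -> sgf m x = sgf m y) -> `|x - y| <= 2 ^- n.
Proof.
move=> hx hy /fold_isometry <-; apply: le_trans (ler_normB _ _) _.
apply: le_trans (lerD hx hy) _; have := hw_le R n.
have -> : (2 * 2 ^+ n)^-1 = 2^-1 * 2 ^- n :> R by rewrite invfM.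
by lra.
Qed.

Lemma eq_of_dist_dyadic x y : (forall n, `|x - y| <= 2 ^- n) -> x = y.
Proof.
move=> xy; apply/eqP; rewrite -subr_eq0 -normr_eq0 eq_le normr_ge0 andbT.
apply/ler_addgt0Pl => e e0; rewrite addr0.
have [n ne] : exists n, 2 ^- n < e.
  have := @cvg_expr R 2^-1; rewrite ger0_norm// => /(_ _)/cvgrPdist_lt.
  have h : 2^-1 < 1 :> R by lra.
  move=> /(_ h _ e0)[n _ /(_ n (leqnn n)) /=].
  by rewrite sub0r normrN ger0_norm ?exprn_ge0// exprVn => ?; exists n.
exact: le_trans (xy n) (ltW ne).
Qed.

(* On the boundary of a level-[n] square the value is rational, so the component
   cannot leave the nested squares around [X]. *)
Lemma component_cantor X : (cantor `*` cantor) X ->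
  (forall q : rat, fcounter X <> ratr q) ->
  connected_component (@square R `&` @fcounter R @^-1` [set fcounter X]) X `<=` [set X].
Proof.
move=> KX irr; have [K1 K2] := KX; set Cc := connected_component _ X.
have CcX : Cc X.
  by apply: connected_component_refl; split=> //; exact: cantor_square.
have conn : connected Cc by exact: component_connected.
have val Y : Cc Y -> fcounter Y = fcounter X.
  by move=> /connected_component_sub[].
have inside n Y : Cc Y -> `|fold n Y.1| < hw R n /\ `|fold n Y.2| < hw R n.
  (* [g] is negative inside the level-[n] squares and zero only on their boundaries, where the value
     is rational. On the component it thus keeps the sign it has at [X]. *)
  pose g (Z : R * R) : R := Num.max `|fold n Z.1| `|fold n Z.2| - hw R n.
  have gc : continuous g.
    move=> Z; apply: cvgB; last exact: cvg_cst.
    apply: (@continuous_max _ _ (fun Z : R * R => `|fold n Z.1|) (fun Z => `|fold n Z.2|)).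
    - apply: cvg_norm; apply: continuous_comp; [exact: cvg_fst|exact: fold_continuous].
    - apply: cvg_norm; apply: continuous_comp; [exact: cvg_snd|exact: fold_continuous].
  have g0 Z : Cc Z -> g Z != 0.
    move=> CZ; apply/eqP => /eqP; rewrite subr_eq0 => /eqP gZ.
    have le1 : `|fold n Z.1| <= hw R n by rewrite -gZ le_max lexx.
    have le2 : `|fold n Z.2| <= hw R n by rewrite -gZ le_max lexx orbT.
    have on : hw R n <= `|fold n Z.1| \/ hw R n <= `|fold n Z.2|.
      by apply/orP; rewrite -le_max gZ.
    have [q qE] : exists q : rat, fcounter Z = ratr q.
      (* Term [k] lives on the squares of level [k.+1]: it is on its plateau if [k.+1 < n] and
         vanishes otherwise. For [n = 0] all terms vanish. *)
      apply: (@fcounter_ratr _ n.-1) => k kn.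
        have kn' : (k.+1 < n)%N by move: kn; case: (n).
        by rewrite !(cell_in kn').
      have kn' : (n <= k.+1)%N by move: kn; case: (n).
      rewrite /fterm; case: on => /cell_dead/(_ kn')[-> _]; by rewrite ?mul0r ?mulr0.
    by apply: (irr q); rewrite -(val Z).
  move=> CY; have gX : g X < 0.
    by rewrite lt_neqAle g0//= subr_le0 ge_max K1 K2.
  have := connected_same_sign conn gc g0 CcX CY; rewrite nmulr_rgt0//.
  by rewrite subr_lt0 gt_max => /andP.
move=> Y CY.
(* Inside the squares of level [m.+1] the function [fold m] has no zero, so its sign is constant on
   the component; points that agree in all signs coincide. *)
have same_sgf m (p : R * R -> R) : continuous p ->
    (forall Z, Cc Z -> `|fold m.+1 (p Z)| < hw R m.+1) -> sgf m (p Y) = sgf m (p X).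
  move=> pc pin; apply: sgr_eq_of_mul_gt0.
  apply: (@connected_same_sign _ Cc (fun Z => fold m (p Z))) => //.
    by move=> Z; apply: continuous_comp; [exact: pc|exact: fold_continuous].
  by move=> Z /pin; exact: fold_neq0.
have eq_coord (p : R * R -> R) : continuous p ->
    (forall m Z, Cc Z -> `|fold m (p Z)| < hw R m) -> p Y = p X.
  move=> pc pin; apply: eq_of_dist_dyadic => n.
  by apply: (@cantor_dist n); try (apply: ltW; exact: pin);
    move=> m _; apply: same_sgf => // Z; exact: pin.
rewrite /= [LHS]surjective_pairing [RHS]surjective_pairing; congr pair.
- by apply: (eq_coord fst) => [Z|m Z /(inside m)[]//]; exact: cvg_fst.
- by apply: (eq_coord snd) => [Z|m Z /(inside m)[]//]; exact: cvg_snd.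
Qed.

(** * Hausdorff measure of a point and the weak Sard property *)

Lemma ediam_set1 X : ediam [set X] = 0%E.
Proof.
apply/eqP; rewrite eq_le; apply/andP; split; last by apply: ereal_sup_ubound; left.
apply: ge_ereal_sup => _ [->//|[[U V] /= [-> ->] <-]].
by rewrite /Defs.edist /= !subrr expr0n /= addr0 sqrtr0.
Qed.

Lemma H1_subset1 X (A : set (R * R)) : A `<=` [set X] -> H1 A = 0%E.
Proof.
move=> AX; apply/eqP; rewrite eq_le; apply/andP; split.
- apply: ge_ereal_sup => _ [d d0 <-]; apply: ereal_inf_lbound.
  exists (fun=> [set X]); last by apply: eseries0 => n _ _; exact: ediam_set1.
  split=> [Y /AX ->|n]; first by exists 0%N.
  by rewrite ediam_set1 lee_fin ltW.
- apply: (@le_trans _ _ (H1_delta 1 A)); last by apply: ereal_sup_ubound; exists 1 => /=.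
  apply: le_ereal_inf_tmp => _ [C _ <-]; apply: nneseries_ge0 => n _ _.
  by apply: ereal_sup_ubound; left.
Qed.

Lemma fcounter_weak_sard : push_singular (@fcounter R) (crit (@fcounter R) `&` Estar (@fcounter R)).
Proof.
have cQ : countable (range (@ratr R)).
  exact: card_le_trans (card_image_le _ _) (countableP _).
exists (range (@ratr R)); split; first exact: countable_measurable.
  exact: countable_lebesgue_measure0.
rewrite (_ : _ `&` _ = set0); first by exists set0; split => //; rewrite /L2 measure0.
apply/seteqP; split=> // X [[cX [_ eX]] irr].
have irr' q : fcounter X <> ratr q by move=> h; apply: irr; exists q.
have [KX|[q /irr' //]] := crit_cantor_or_ratr cX.
by move: eX; rewrite (H1_subset1 (component_cantor KX irr')) ltxx.
Qed.

End Cantor.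

(** * Measure of the Cantor set and of preimages of intervals *)

Section CantorMeasure.
Variable R : realType.
Local Notation mu := (@lebesgue_measure R).

Lemma measurable_continuous_preimage (g : R -> R) (A : set R) :
  continuous g -> measurable A -> measurable (g @^-1` A).
Proof.
by move=> cg mA; rewrite -[X in measurable X]setTI; apply: continuous_measurable_fun.
Qed.

Lemma continuous_subr (h : R) : continuous (fun x : R => x - h).
Proof. by move=> x; apply: cvgB; [exact: cvg_id|exact: cvg_cst]. Qed.

Lemma continuous_norm_subr (h : R) : continuous (fun x : R => `|x| - h).
Proof. by move=> x; apply: cvgB; [apply: cvg_norm; exact: cvg_id|exact: cvg_cst]. Qed.

Lemma lebesgue_measure_shift (A : set R) (h : R) : measurable A ->
  mu [set x | A (x - h)] = mu A.
Proof.
move=> mA.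
have ms : measurable_fun [set: R] (fun x : R => x - h).
  by apply: continuous_measurable_fun; exact: continuous_subr.
have U := @lebesgue_measure_unique R
  (pushforward mu (fun x : measurableTypeR R => x - h : measurableTypeR R)).
rewrite (U ms _ A mA)// => _ [[a b] _ <-]; rewrite /pushforward.
transitivity (mu `]a + h, b + h]%classic); last first.
  by congr (mu _); apply/seteqP; split=> x /=; rewrite !in_itv /= ltrBrDr lerBlDr.
by rewrite !lebesgue_measure_itv /= !lte_fin ltrD2r -!EFinB opprD addrACA subrr addr0.
Qed.

(** The preimage contains the translate of [A] by [h] and its mirror image. These lie on opposite
    half-lines and can meet only at 0, which is removed from one of them. *)
Lemma lebesgue_measure_fold_ge (A : set R) (h : R) : measurable A ->
  A `<=` [set w | - h <= w] -> (2%:E * mu A <= mu [set x : R | A (`|x| - h)%R])%E.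
Proof.
move=> mA Ah.
have mB : measurable [set x : R | A (x - h)].
  exact: (measurable_continuous_preimage (@continuous_subr h)).
set B := [set x : R | A (x - h)] in mB.
have muB : mu B = mu A by exact: lebesgue_measure_shift.
have mNB : measurable [set x : R | B (- x)].
  apply: (@measurable_continuous_preimage -%R) => // x; exact: continuousN.
set NB := [set x : R | B (- x)] in mNB.
have muNB : mu NB = mu A by rewrite -muB -[RHS]lebesgue_measureN.
have m1 : measurable [set 0 : R] by exact: measurable_set1.
have muB0 : mu (B `\` [set 0]) = mu A.
  rewrite -muB; apply/eqP; rewrite eq_le; apply/andP; split.
    apply: le_measure; [rewrite inE; exact: measurableD|by rewrite inE|exact: subDsetl].
  have : (mu B <= mu (B `\` [set 0%R] `|` [set 0%R]))%E.
    apply: le_measure; first by rewrite inE.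
      by rewrite inE; apply: measurableU => //; exact: measurableD.
    by move=> x Bx; have [->|x0] := eqVneq x 0; [right|left; split => //; apply/eqP].
  move=> /le_trans; apply.
  have U2 : (mu (B `\` [set 0%R] `|` [set 0%R]) <= mu (B `\` [set 0%R]) + mu [set 0%R])%E.
    by apply: measureU2 => //; exact: measurableD.
  by apply: le_trans U2 _; rewrite lebesgue_measure_set1 adde0.
have disj : (B `\` [set 0]) `&` NB = set0.
  apply/seteqP; split=> // x [[/Ah /= xh x0] /Ah /= xh'].
  by apply: x0; rewrite /=; lra.
rewrite (_ : 2%:E * mu A = mu (B `\` [set 0%R]) + mu NB)%E; last first.
  by rewrite muB0 muNB mule_natl mule2n.
rewrite -measureU//; last exact: measurableD.
apply: le_measure.
- by rewrite inE; apply: measurableU => //; exact: measurableD.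
- rewrite inE; exact: (measurable_continuous_preimage (@continuous_norm_subr h)).
- move=> x [[Bx _]|NBx] /=.
    have /= := Ah _ Bx; move=> xh; rewrite ger0_norm//; lra.
  have /= := Ah _ NBx; move=> xh; rewrite ler0_norm//; lra.
Qed.

Lemma measurable_fold n (A : set R) : measurable A -> measurable (@fold R n @^-1` A).
Proof.
exact: (measurable_continuous_preimage (@fold_continuous _ n)).
Qed.

(** Each fold at least doubles the measure. The induction continues because the preimage lies within
    [2 * hw n.+1 < hw n] of the centre. *)
Lemma fold_preimage_ge n (A : set R) : measurable A ->
  A `<=` [set w | `|w| <= hw R n] -> ((2 ^+ n)%:E * mu A <= mu (@fold R n @^-1` A))%E.
Proof.
elim: n A => [|n IHn] A mA Ah.
  by rewrite expr0 mul1e -(lebesgue_measure_shift 2^-1 mA).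
have Ah' : A `<=` [set w | - hw R n.+1 <= w].
  by move=> w /Ah /=; rewrite ler_norml => /andP[].
have := lebesgue_measure_fold_ge mA Ah'.
pose A' := [set x : R | A (`|x| - hw R n.+1)].
move=> h; have mA' : measurable A'.
  exact: (measurable_continuous_preimage (@continuous_norm_subr _)).
apply: le_trans (IHn A' mA' _).
- rewrite exprSr EFinM -muleA; apply: lee_wpmul2l; last exact: h.
  by rewrite lee_fin exprn_ge0.
- move=> x /Ah /=; rewrite ler_norml => /andP[_].
  by have := hwS_lt R n; lra.
Qed.

Lemma cantor_measurable : measurable (@cantor R).
Proof.
rewrite (_ : @cantor R = \bigcap_n (@fold R n @^-1` `[- hw R n, hw R n]%classic)).
  by apply: bigcap_measurable => // n _; exact: measurable_fold.
apply/seteqP; split=> x /= h n; first by move=> _; rewrite /= in_itv /= -ler_norml.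
by have := h n I; rewrite /= in_itv /= -ler_norml.
Qed.

(** By unfolding, stage [n] has measure at least [2 ^+ n * (2 * hw n)], hence at least 1/2; the
    stages decrease to the Cantor set. *)
Lemma cantor_measure_ge : (2^-1%:E <= mu (@cantor R))%E.
Proof.
pose F n := @fold R n @^-1` `[- hw R n, hw R n]%classic.
have mF n : measurable (F n) by exact: measurable_fold.
have FE n x : F n x = (`|fold n x| <= hw R n) :> Prop by rewrite /F /= in_itv /= -ler_norml.
have cE : @cantor R = \bigcap_n F n.
  apply/seteqP; split=> x /= h n; first by move=> _; rewrite FE.
  by have := h n I; rewrite FE.
have muF n : (2^-1%:E <= mu (F n))%E.
  apply: le_trans (fold_preimage_ge (n := n) _ _) => //; last first.
    by move=> w /=; rewrite in_itv /= -ler_norml.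
  rewrite lebesgue_measure_itv /= lte_fin gtrN ?hw_gt0// -EFinB -EFinM lee_fin opprK.
  have := hw_ge R n; have p0 : 0 < 2 ^+ n :> R by rewrite exprn_gt0.
  move=> /(ler_wpM2l (ltW p0)).
  rewrite (_ : 2 ^+ n * (4 * 2 ^+ n)^-1 = 4^-1); last by field; rewrite gt_eqF.
  by rewrite mulrDr; lra.
have := @nonincreasing_cvg_mu _ _ _ mu F; rewrite -cE => cvF.
have {}cvF : mu \o F @ \oo --> mu (@cantor R).
  apply: cvF => //; last 2 first.
  - exact: cantor_measurable.
  - apply/nonincreasing_seqP => n; apply/subsetPset => x; rewrite !FE => h.
    by apply: ltW; apply: fold_alive_lt h.
  rewrite (_ : F 0%N = `[0, 1]%classic).
    by rewrite /= lebesgue_measure_itv /= lte_fin ltr01 -EFinB ltry.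
  apply/seteqP; split=> x; rewrite FE /= hw0 in_itv /= ler_norml => /andP[? ?];
    by apply/andP; split; lra.
rewrite -(cvg_lim _ cvF)//; apply: lime_ge; first exact: cvgP cvF.
by near=> n; exact: muF.
Unshelve. all: by end_near. Qed.

End CantorMeasure.

(** * Covering preimages of intervals, and failure of the relaxed Sard property *)

Section Covering.
Variable R : realType.
Implicit Types (X Y Z : R * R) (n m : nat).
Local Notation mu := (@lebesgue_measure R).
Local Notation K := (@cantor R `*` @cantor R).

Definition same_code n X Y : Prop :=
  forall m, (m < n)%N -> sgf m X.1 = sgf m Y.1 /\ sgf m X.2 = sgf m Y.2.

Lemma cantor_sgf n (x : R) : cantor x -> sgf n x = 1 \/ sgf n x = -1.
Proof.
move=> cx; rewrite /sgf.
have : fold n x != 0.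
  by apply: (fold_neq0 (ltnSn n)); apply: fold_alive_lt (cx n.+2).
by case: sgrP => // _ _; [left|right].
Qed.

Lemma fterm_cantor n X : K X -> fterm n X = 4 ^- n * (2 * sgf n X.1 + sgf n X.2).
Proof.
by move=> [K1 K2]; rewrite /fterm (cell_in _ (K1 n.+2))// (cell_in _ (K2 n.+2))// !mulr1.
Qed.

(* The digits [2 * sgf + sgf] lie in {-3, -1, 1, 3}, hence distinct ones are at
   distance at least 2, and the later digits cannot close this gap. *)
Lemma series_separation n X Y : K X -> K Y ->
  (same_code n X Y /\ series (@fterm R ^~ X) n = series (@fterm R ^~ Y) n) \/
  8 * 4 ^- n <= `|series (@fterm R ^~ X) n - series (@fterm R ^~ Y) n|.
Proof.
move=> KX KY; elim: n => [|n IHn].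
  by left; split=> //; rewrite /series /= !big_nil.
rewrite !seriesSr.
have p0 : 0 < 4 ^- n :> R by rewrite invr_gt0 exprn_gt0.
have -> : 4 ^- n.+1 = 4^-1 * 4 ^- n :> R by rewrite exprS invfM.
rewrite !fterm_cantor//.
have X1 := cantor_sgf n KX.1; have X2 := cantor_sgf n KX.2.
have Y1 := cantor_sgf n KY.1; have Y2 := cantor_sgf n KY.2.
move: (series _ n) (series _ n) IHn => SX SY [[sXY ->]|far].
  have [e1|e1] := eqVneq (sgf n X.1) (sgf n Y.1); last first.
    right; rewrite leNgt; apply/negP; rewrite ltr_norml => /andP[h1 h2].
    case: X1 X2 Y1 Y2 h1 h2 e1 => -> [] -> [] -> [] -> //; rewrite ?eqxx//; lra.
  have [e2|e2] := eqVneq (sgf n X.2) (sgf n Y.2); last first.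
    right; rewrite leNgt; apply/negP; rewrite ltr_norml => /andP[h1 h2].
    case: X1 X2 Y1 Y2 h1 h2 e2 => -> [] -> [] -> [] -> //; rewrite ?eqxx//; lra.
  left; split; last by rewrite e1 e2.
  move=> m; rewrite ltnS leq_eqVlt => /predU1P[->//|]; exact: sXY.
(* A gap of [8 * 4 ^- n] shrinks by at most [6 * 4 ^- n], which leaves [8 * 4 ^- n.+1]. *)
right; rewrite leNgt; apply/negP; rewrite ltr_norml => /andP[h1 h2].
move: far; rewrite leNgt => /negP; apply; rewrite ltr_norml.
by case: X1 X2 Y1 Y2 h1 h2 => -> [] -> [] -> [] -> h1 h2; apply/andP; split; lra.
Qed.

Lemma fcounter_tail n X : `|fcounter X - series (@fterm R ^~ X) n| <= 4 * 4 ^- n.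
Proof.
have L : series (@fterm R ^~ X) (n + k)%N - series (@fterm R ^~ X) n @[k --> \oo] -->
    fcounter X - series (@fterm R ^~ X) n.
  apply: cvgB; last exact: cvg_cst.
  have := @fcounter_cvg R X; rewrite -(cvg_shiftn n).
  by under eq_fun do rewrite addnC.
apply: (norm_cvgn_le L) => k.
have p0 j : 0 < 4 ^- j :> R by rewrite invr_gt0 exprn_gt0.
(* The term bound [3 * 4 ^- j] is exactly the drop of [4 * 4 ^- j] to the next level, so this
   sharper bound passes through the induction. *)
suff : `|series (@fterm R ^~ X) (n + k)%N - series (@fterm R ^~ X) n| <=
    4 * 4 ^- n - 4 * 4 ^- (n + k)%N.
  by move=> /le_trans; apply; rewrite gerBl mulr_ge0// ltW.
elim: k => [|k IHk]; first by rewrite addn0 !subrr normr0.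
rewrite addnS seriesSr addrAC.
apply: le_trans (ler_normD _ _) (le_trans (lerD IHk (fterm_bound _ _)) _).
have -> : 4 ^- (n + k).+1 = 4^-1 * 4 ^- (n + k)%N :> R by rewrite exprS invfM.
by lra.
Qed.

Definition box X (r : R) : set (R * R) :=
  `[X.1 - r, X.1 + r]%classic `*` `[X.2 - r, X.2 + r]%classic.

Lemma box_measurable X r : measurable (box X r : set (measurableTypeR R * measurableTypeR R)).
Proof. exact: measurableX. Qed.

Lemma box_measure X r : 0 < r -> (L2 (box X r) = (4 * r ^+ 2)%:E)%E.
Proof.
move=> r0; rewrite /L2 /box product_measure1E//= !lebesgue_measure_itv /=.
rewrite !lte_fin !ltrD2l gtrN// -!EFinB -EFinM; congr EFin; ring.
Qed.

Lemma same_code_box n X Y : K X -> K Y -> same_code n X Y -> box X (2 ^- n) Y.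
Proof.
move=> [X1 X2] [Y1 Y2] s.
have h1 : `|X.1 - Y.1| <= 2 ^- n by apply: cantor_dist (X1 n) (Y1 n) _ => m /s[].
have h2 : `|X.2 - Y.2| <= 2 ^- n by apply: cantor_dist (X2 n) (Y2 n) _ => m /s[].
split; rewrite /= in_itv /=; [move: h1|move: h2]; rewrite ler_norml => /andP[? ?];
  by apply/andP; split; lra.
Qed.

(** At most two codes occur in [E]. Among three, the partial sums would be pairwise [8 * 4 ^- n]
    apart, so two of them [16 * 4 ^- n] apart; close values and two tails of [4 * 4 ^- n] allow only
    [9 * 4 ^- n]. *)
Lemma cover_by_boxes n (E : set (R * R)) : E `<=` K ->
  ((0 < n)%N -> forall X Y, E X -> E Y -> `|fcounter X - fcounter Y| <= 4 ^- n) ->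
  exists X Y, E `<=` box X (2 ^- n) `|` box Y (2 ^- n).
Proof.
move=> EK fE.
have [[X EX]|nE] := pselect (exists X, E X); last first.
  by exists (0, 0), (0, 0) => X EX; exfalso; apply: nE; exists X.
have [[Y [EY nXY]]|all_same] := pselect (exists Y, E Y /\ ~ same_code n X Y); last first.
  exists X, X => Z EZ; left; apply: same_code_box; [exact: EK|exact: EK|].
  by apply: contrapT => h; apply: all_same; exists Z.
exists X, Y => Z EZ.
have [sX|nXZ] := pselect (same_code n X Z).
  by left; apply: same_code_box => //; exact: EK.
have [sY|nYZ] := pselect (same_code n Y Z).
  by right; apply: same_code_box => //; exact: EK.
exfalso.
(* At level 0 all points share the empty code, so distinct codes make the closeness hypothesis
   available. *)
have n0 : (0 < n)%N by rewrite lt0n; apply/eqP => n0; apply: nXY => m; rewrite n0.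
have fn := fE n0.
have p0 : 0 < 4 ^- n :> R by rewrite invr_gt0 exprn_gt0.
have far U V : E U -> E V -> ~ same_code n U V ->
    8 * 4 ^- n <= `|series (@fterm R ^~ U) n - series (@fterm R ^~ V) n|.
  by move=> /EK KU /EK KV nUV; case: (series_separation n KU KV) => // -[/nUV].
have close U V : E U -> E V ->
    `|series (@fterm R ^~ U) n - series (@fterm R ^~ V) n| <= 9 * 4 ^- n.
  move=> EU EV; have := fn U V EU EV; have := fcounter_tail n U; have := fcounter_tail n V.
  by rewrite !ler_norml => /andP[? ?] /andP[? ?] /andP[? ?]; apply/andP; split; lra.
have := far X Y EX EY nXY; have := far X Z EX EZ nXZ; have := far Y Z EY EZ nYZ.
have := close X Y EX EY; have := close X Z EX EZ; have := close Y Z EY EZ.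
rewrite !ler_norml !ler_normr => /andP[? ?] /andP[? ?] /andP[? ?].
by case/orP=> ? /orP[] ? /orP[] ?; lra.
Qed.

Lemma interval_preimage_cover (a b : R) : a < b -> exists B : set (R * R),
  [/\ measurable (B : set (measurableTypeR R * measurableTypeR R)),
      K `&` @fcounter R @^-1` `]a, b]%classic `<=` B & (L2 B <= (32 * (b - a))%:E)%E].
Proof.
move=> ab; have l0 : 0 < b - a by rewrite subr_gt0.
have exn : exists n, 4 ^- n <= 4 * (b - a).
  have := @cvg_expr R 4^-1; rewrite ger0_norm// => /(_ _)/cvgrPdist_lt.
  have h : 4^-1 < 1 :> R by lra.
  move=> /(_ h _ l0)[n _ /(_ n (leqnn n)) /=].
  rewrite sub0r normrN ger0_norm ?exprn_ge0// exprVn => ?; exists n; lra.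
(* Minimality gives [b - a < 4 ^- n] for positive [n], hence closeness of values. The two boxes have
   total area at most [8 * 4 ^- n], which is at most [32 * (b - a)]. *)
have [n hn nmin] := ex_minnP exn.
pose E := K `&` @fcounter R @^-1` `]a, b]%classic.
have [||X [Y EB]] := @cover_by_boxes n E; first exact: subIsetl.
  case: n hn nmin => // n hn nmin _ X Y [_ /=] + [_ /=]; rewrite !in_itv /=.
  move=> /andP[? ?] /andP[? ?].
  have : 4 * (b - a) < 4 ^- n by rewrite ltNge; apply/negP => /nmin; rewrite ltnn.
  have -> : 4 ^- n.+1 = 4^-1 * 4 ^- n :> R by rewrite exprS invfM.
  by move=> ?; rewrite ler_norml; apply/andP; split; lra.
exists (box X (2 ^- n) `|` box Y (2 ^- n)); split => //.
  by apply: measurableU; exact: box_measurable.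
have r0 : 0 < 2 ^- n :> R by rewrite invr_gt0 exprn_gt0.
have U2 : (L2 (box X (2 ^- n) `|` box Y (2 ^- n)) <= L2 (box X (2 ^- n)) + L2 (box Y (2 ^- n)))%E.
  by rewrite /L2; apply: measureU2; exact: box_measurable.
apply: le_trans U2 _; rewrite !box_measure// -EFinD lee_fin.
have -> : (2 ^- n) ^+ 2 = 4 ^- n :> R.
  by rewrite -exprVn -exprM mulnC exprM -exprVn; congr (_ ^+ _); field.
by lra.
Qed.

Lemma ocitv_preimage_cover (A : set R) : ocitv A -> exists B : set (R * R),
  [/\ measurable (B : set (measurableTypeR R * measurableTypeR R)),
      K `&` @fcounter R @^-1` A `<=` B & (L2 B <= 32%:E * wlength idfun A)%E].
Proof.
move=> [[a b] _ <-]; have [ab|ba] := ltP a b.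
  have [B [mB KB muB]] := interval_preimage_cover ab; exists B; split => //.
  have wE : wlength idfun `]a, b]%classic = (b - a)%:E by rewrite wlength_itv_bnd ?ltW.
  by rewrite [X in (_ <= _ * X)%E]wE -EFinM.
exists set0; split=> //; last by rewrite /L2 measure0 mule_ge0// wlength_ge0.
by move=> X [_ /=]; rewrite in_itv /= => /andP[h1 h2]; lra.
Qed.

Lemma cantor_square_measure_ge : ((4^-1)%:E <= L2 K)%E.
Proof.
have mc := @cantor_measurable R.
rewrite /L2 /= product_measure1E//.
have -> : (4^-1)%:E = ((2^-1)%:E * (2^-1)%:E)%E :> \bar R by rewrite -EFinM; congr EFin; field.
by apply: lee_pmul => //; exact: cantor_measure_ge.
Qed.

Lemma fcounter_not_relaxed_sard : ~ push_singular (@fcounter R) (crit (@fcounter R)).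
Proof.
move=> [N [mN muN [D [mD muD ND]]]].
(* Intervals of total length below [e] pull back to area at most 1/8, too little for the Cantor
   square of area at least 1/4. *)
pose e : R := 8^-1 / 32.
have : (mu N < e%:E)%E by rewrite muN lte_fin divr_gt0.
(* Lebesgue measure unfolds to an infimum over countable covers by half-open intervals. *)
move=> /ereal_inf_ltP[_ [A [mA NA] <-] sumA].
have /choice[B BP] : forall k, exists B : set (R * R),
  [/\ measurable (B : set (measurableTypeR R * measurableTypeR R)),
      K `&` @fcounter R @^-1` (A k) `<=` B & (L2 B <= 32%:E * wlength idfun (A k))%E].
  by move=> k; exact/ocitv_preimage_cover/mA.
have mB k : measurable (B k : set (measurableTypeR R * measurableTypeR R)).
  by have [] := BP k.
have mUB := bigcup_measurable (fun k (_ : [set: nat] k) => mB k).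
have mK : measurable (K : set (measurableTypeR R * measurableTypeR R)).
  by apply: measurableX; exact: cantor_measurable.
have KDB : K `<=` D `|` \bigcup_k B k.
  move=> X KX; have [/NA[k _ Ak]|nN] := pselect (N (fcounter X)).
    by right; exists k => //; have [_ h _] := BP k; exact: h.
  by left; apply: ND; split=> //; exact: cantor_crit.
have h1 : (L2 K <= L2 (D `|` \bigcup_k B k))%E.
  by rewrite /L2; apply: le_measure => //; rewrite inE//; exact: measurableU.
have h2 : (L2 (D `|` \bigcup_k B k) <= L2 D + L2 (\bigcup_k B k))%E.
  by rewrite /L2; exact: measureU2.
have h3 : (L2 (\bigcup_k B k) <= \sum_(k <oo) L2 (B k))%E.
  by rewrite /L2; exact: generalized_Boole_inequality.
have h4 : (\sum_(k <oo) L2 (B k) <= 32%:E * \sum_(k <oo) wlength idfun (A k))%E.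
  rewrite -nneseriesZl; last by move=> *; exact: wlength_ge0.
  apply: lee_nneseries => k _; first by rewrite /L2.
  by have [] := BP k.
have : (L2 K <= (8^-1)%:E)%E.
  apply: le_trans h1 (le_trans h2 _); rewrite muD add0e.
  apply: le_trans h3 (le_trans h4 _).
  have -> : 8^-1 = 32 * e by rewrite /e; field.
  by rewrite EFinM; apply: lee_wpmul2l => //; exact: ltW.
move=> /(le_trans cantor_square_measure_ge); rewrite lee_fin; lra.
Qed.

End Covering.

Theorem theorem2 (R : realType) :
  exists f : R * R -> R,
    C1alpha_all f /\
    push_singular f (crit f `&` Estar f) /\
    ~ push_singular f (crit f).
Proof.
exists (@fcounter R); split; first exact: fcounter_C1alpha.
by split; [exact: fcounter_weak_sard|exact: fcounter_not_relaxed_sard].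
Qed.
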